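(* Let $N\ge1$ and let $u$ be the solution of $\partial_tu=\Delta u+f(u)$ in $(0,+\infty)\times\mathbb R^N$ with $f(s)=s(1-s)$ for $s\in[0,1]$ and initial datum $u_0=\mathbf 1_U$, where $$U=\big\{x=(x',x_N)\in\mathbb R^{N-1}\times\mathbb R:|x_N|\le e^{-|x'|^2}\big\}.$$ The set $U$ has a non-empty interior, and for every $\rho>0$ it fulfills neither $(G_\rho)$ nor $(D_\rho)$. Then properties (i), (ii), (iii), (iv) and (v) of the context all fail (with $w$ and $\mathcal W$ as defined in the context), and the two limits $\lim_{t\to+\infty}\frac1tE_\lambda(t)$ (for $\lambda\in(0,1)$) and $\lim_{t\to+\infty}\big(\frac1tU+B_{c^*}\big)$, in the sense of the Hausdorff distance, exist but do not coincide: that is, for any $\lambda\in(0,1)$ there are sets $\mathcal W_1,\mathcal W_2\subset\mathbb R^N$ with $d_{\mathcal H}(\frac1tE_\lambda(t),\mathcal W_1)\to0$ and $d_{\mathcal H}(\frac1tU+B_{c^*},\mathcal W_2)\to0$ as $t\to+\infty$, and $d_{\mathcal H}(\mathcal W_1,\mathcal W_2)\neq0$.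
   Context: $B_r(x)$ is the open Euclidean ball in $\mathbb R^N$, $B_r=B_r(0)$; $\mathbb S^{N-1}$ is the unit sphere; $\mathrm{dist}(x,A)=\inf\{|y-x|:y\in A\}$ with $\mathrm{dist}(x,\emptyset)=+\infty$. The function $f$ is extended by $0$ outside $[0,1]$. The solution with initial datum $u_0$ is the unique bounded classical solution with $u(t,\cdot)\to u_0$ in $L^1_{loc}(\mathbb R^N)$ as $t\to0^+$. $c^*=2$ is the minimal speed of planar traveling fronts connecting $1$ to $0$ for this $f$. $E_\lambda(t)=\{x\in\mathbb R^N:u(t,x)>\lambda\}$. The Hausdorff distance of $A,B\subset\mathbb R^N$ is $d_{\mathcal H}(A,B)=\max\big(\sup_{x\in A}\mathrm{dist}(x,B),\sup_{y\in B}\mathrm{dist}(y,A)\big)$, with $d_{\mathcal H}(A,\emptyset)=d_{\mathcal H}(\emptyset,A)=+\infty$ if $A\ne\emptyset$ and $d_{\mathcal H}(\emptyset,\emptyset)=0$. For $A\subset\mathbb R^N$: $\mathcal B(A)=\{\xi\in\mathbb S^{N-1}:\liminf_{\tau\to+\infty}\mathrm{dist}(\tau\xi,A)/\tau>0\}$, $\mathcal U(A)=\{\xi\in\mathbb S^{N-1}:\lim_{\tau\to+\infty}\mathrm{dist}(\tau\xi,A)/\tau=0\}$; $U_\rho=\{x\in U:\mathrm{dist}(x,\partial U)\ge\rho\}$. $w(e)=\sup_{\xi\in\mathcal U(U),\,\xi\cdot e\ge0}c^*/\sqrt{1-(\xi\cdot e)^2}$ for $e\in\mathbb S^{N-1}$,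 with $w(e)=c^*$ if there is no $\xi\in\mathcal U(U)$ with $\xi\cdot e\ge0$, and $w(e)=+\infty$ if $e\in\mathcal U(U)$. $\mathcal W=\{re:e\in\mathbb S^{N-1},\ 0\le r<w(e)\}$. Conditions: $(G_\rho)$: $\mathcal B(U)\cup\mathcal U(U_\rho)=\mathbb S^{N-1}$. $(D_\rho)$: $d_{\mathcal H}(U,U_\rho)<+\infty$. Properties: (i) for every $e\in\mathbb S^{N-1}$: $u(t,cte)\to1$ as $t\to+\infty$ for every $0\le c<w(e)$, and $u(t,cte)\to0$ as $t\to+\infty$ for every $c>w(e)$. (ii) for every $e\in\mathbb S^{N-1}$: $\lim_{t\to+\infty}\min_{0\le s\le c}u(t,ste)=1$ for every $0\le c<w(e)$, and $\lim_{t\to+\infty}\sup_{s\ge c}u(t,ste)=0$ for every $c>w(e)$. (iii) for every compact set $C\subset\mathbb R^N$: $\lim_{t\to+\infty}\min_{x\in C}u(t,tx)=1$ if $C\subset\mathcal W$, and $\lim_{t\to+\infty}\max_{x\in C}u(t,tx)=0$ if $C\subset\mathbb R^N\setminus\overline{\mathcal W}$. (iv) for every $R>0$ and $\lambda\in(0,1)$: $d_{\mathcal H}\big(\overline{B_R}\cap\frac1tE_\lambda(t),\overline{B_R}\cap\mathcal W\big)\to0$ as $t\to+\infty$. (v) for every $\lambda\in(0,1)$: $d_{\mathcal H}(E_\lambda(t),U+B_{c^*t})=o(t)$ as $t\to+\infty$.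
   Formalization: The theorem assumes N ≥ 2 instead of N ≥ 1: for N = 1 the set U is [-1,1], so (G_ρ) holds for every ρ, (D_ρ) holds for ρ ≤ 1, and the two Hausdorff limits coincide, so the claim is false there. *)

(* Defs.v *)
From HB Require Import structures.
From mathcomp Require Import all_boot all_order all_algebra.
From mathcomp Require Import all_classical all_reals all_analysis.

Set Implicit Arguments.
Unset Strict Implicit.
Unset Printing Implicit Defensive.
Import Order.TTheory GRing.Theory Num.Theory.
Import numFieldNormedType.Exports.

Local Open Scope classical_set_scope.
Local Open Scope ring_scope.

Section cons_measure.
Context {R : realType} {d : measure_display} {T : measurableType d} {n : nat}.
Variables (m1 : {sigma_finite_measure set T -> \bar R})
          (m2 : {sigma_finite_measure set (n.-tuple T) -> \bar R}).

Definition cons_pair (p : T * n.-tuple T) : n.+1.-tuple T :=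
  [the n.+1.-tuple T of p.1 :: p.2].

Lemma measurable_cons_pair : measurable_fun [set: T * n.-tuple T] cons_pair.
Proof. by apply: measurable_cons. Qed.

Definition cons_measure : set (n.+1.-tuple T) -> \bar R :=
  pushforward (m1 \x m2)%E cons_pair.

Let pf0 : cons_measure set0 = 0%E.
Proof. by rewrite /cons_measure /pushforward preimage_set0 measure0. Qed.

Let pf_ge0 A : (0 <= cons_measure A)%E.
Proof. by rewrite /cons_measure /pushforward; exact: (measure_ge0 (m1 \x m2)%E). Qed.

Let pf_sigma : semi_sigma_additive cons_measure.
Proof.
move=> F mF tF mUF; rewrite /cons_measure /pushforward preimage_bigcup.
apply: measure_semi_sigma_additive.
- by move=> k; rewrite -[X in measurable X]setTI; exact: measurable_cons_pair.
- apply/trivIsetP => /= i j _ _ ij; rewrite -preimage_setI.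
  by move/trivIsetP : tF => /(_ _ _ _ _ ij) ->//; rewrite preimage_set0.
- by rewrite -preimage_bigcup -[X in measurable X]setTI;
    exact: measurable_cons_pair.
Qed.

HB.instance Definition _ := isMeasure.Build _ _ _ cons_measure pf0 pf_ge0 pf_sigma.

Let uncons (t : n.+1.-tuple T) : T * n.-tuple T := (thead t, [tuple of behead t]).

Let unconsK p : uncons (cons_pair p) = p.
Proof. by case: p => x t; congr (_, _); apply: val_inj. Qed.

Let measurable_uncons : measurable_fun [set: n.+1.-tuple T] uncons.
Proof.
apply/measurable_fun_pairP; split; first exact: (measurable_tnth ord0).
exact: measurable_behead.
Qed.

Let cons_measure_sigma_finite : sigma_finite setT cons_measure.
Proof.
have /sigma_finiteP[F [TF ndF Foo]] := sigma_finiteT m1.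
have /sigma_finiteP[G [TG ndG Goo]] := sigma_finiteT m2.
exists (fun i => uncons @^-1` (F i `*` G i)).
  rewrite -preimage_bigcup (_ : \bigcup_i _ = setT) ?preimage_setT//.
  rewrite -subTset => -[x y] _.
  have [i _ Fi] : (\bigcup_i F i) x by rewrite -TF.
  have [j _ Gj] : (\bigcup_i G i) y by rewrite -TG.
  exists (maxn i j) => //; split => /=.
    by move: x Fi; exact/subsetPset/ndF/leq_maxl.
  by move: y Gj; exact/subsetPset/ndG/leq_maxr.
move=> i; have [mF Fi] := Foo i; have [mG Gi] := Goo i; split.
  by rewrite -[X in measurable X]setTI; apply: measurable_uncons => //;
    exact: measurableX.
rewrite /cons_measure /pushforward -comp_preimage.
rewrite (_ : uncons \o cons_pair = id) ?preimage_id; last first.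
  by apply/funext => p /=; rewrite unconsK.
by rewrite product_measure1E// lte_mul_pinfty// ge0_fin_numE.
Qed.

HB.instance Definition _ :=
  Measure_isSigmaFinite.Build _ _ _ cons_measure cons_measure_sigma_finite.

End cons_measure.

(** [R^n] carries the Borel product sigma-algebra when seen as
    [n.-tuple (measurableTypeR R)]; the measure is the [n]-fold product of the
    one-dimensional Lebesgue measure, the Dirac mass for [n = 0]. *)
Fixpoint lebesgue_tuple (R : realType) (n : nat) :
    {sigma_finite_measure set (n.-tuple (measurableTypeR R)) -> \bar R} :=
  if n is k.+1 then cons_measure (@lebesgue_measure R) (lebesgue_tuple R k)
  else \d_ [tuple].

Section euclidean.
Context {R : realType} {n : nat}.
Implicit Types (x y e : 'rV[R]_n) (A B : set 'rV[R]_n).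

Definition dot x y : R := \sum_i x 0 i * y 0 i.

(** The norm [`|x|] of the library is the max-norm (it induces the same
    topology). *)
Definition enorm x : R := Num.sqrt (dot x x).

Definition eball x (r : R) : set 'rV[R]_n := [set y | enorm (y - x) < r].

Definition usphere : set 'rV[R]_n := [set e | enorm e = 1].

Definition edist_set x A : \bar R := ereal_inf [set (enorm (y - x))%:E | y in A].

(** The outer [maxe 0] only matters when [A] and [B] are both empty, since
    [ereal_sup set0 = -oo]. *)
Definition hausdorff A B : \bar R :=
  maxe 0%E (maxe (ereal_sup [set edist_set x B | x in A])
                 (ereal_sup [set edist_set y A | y in B])).

Definition boundary A : set 'rV[R]_n := closure A `\` interior A.

Definition scale_set (a : R) A : set 'rV[R]_n := [set a *: x | x in A].

Definition minkowski_sum A B : set 'rV[R]_n := [set x + y | x in A & y in B].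

Definition bounded_directions A : set 'rV[R]_n :=
  [set xi | usphere xi /\
    (0 < limf_einf (fun tau : R => edist_set (tau *: xi) A * (tau^-1)%:E)
           (pinfty_nbhs R))%E].

Definition unbounded_directions A : set 'rV[R]_n :=
  [set xi | usphere xi /\
    (edist_set (tau *: xi) A * (tau^-1)%:E)%E @[tau --> +oo%R] --> 0%E].

Definition interior_part A (rho : R) : set 'rV[R]_n :=
  [set x | A x /\ (rho%:E <= edist_set x (boundary A))%E].

Definition condition_G A (rho : R) : Prop :=
  bounded_directions A `|` unbounded_directions (interior_part A rho) = usphere.

Definition condition_D A (rho : R) : Prop :=
  (hausdorff A (interior_part A rho) < +oo)%E.

End euclidean.

Section solution.
Context {R : realType} {n : nat}.
Implicit Types (u : R -> 'rV[R]_n -> R).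

Definition pos_continuous (g : R -> 'rV[R]_n -> R) : Prop :=
  forall (t : R) (x : 'rV[R]_n), 0 < t ->
    {for (t, x), continuous (fun p : R * 'rV[R]_n => g p.1 p.2)}.

Definition dt u : R -> 'rV[R]_n -> R := fun t x => derive1 (u ^~ x) t.

Definition dx (i : 'I_n) u : R -> 'rV[R]_n -> R :=
  fun t x => 'D_(delta_mx 0 i) (u t) x.

Definition laplacian u : R -> 'rV[R]_n -> R :=
  fun t x => \sum_i dx i (dx i u) t x.

(** The values of [u] at nonpositive times are irrelevant. *)
Definition class_C12 u : Prop :=
  [/\ pos_continuous u,
      (forall (t : R) (x : 'rV[R]_n), 0 < t -> derivable (u ^~ x) t 1) /\
      pos_continuous (dt u),
      forall i : 'I_n,
      (forall (t : R) (x : 'rV[R]_n), 0 < t -> derivable (u t) x (delta_mx 0 i)) /\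
      pos_continuous (dx i u)
    & forall i j : 'I_n,
      (forall (t : R) (x : 'rV[R]_n), 0 < t ->
         derivable (dx i u t) x (delta_mx 0 j)) /\
      pos_continuous (dx j (dx i u))].

Definition row_of_tuple (v : n.-tuple (measurableTypeR R)) : 'rV[R]_n :=
  \row_i (tnth v i : R).

Definition L1_dist (K : set 'rV[R]_n) (g h : 'rV[R]_n -> R) : \bar R :=
  (\int[lebesgue_tuple R n]_(v in row_of_tuple @^-1` K)
     `|g (row_of_tuple v) - h (row_of_tuple v)|%:E)%E.

Definition bounded_classical_solution (f : R -> R) (u0 : 'rV[R]_n -> R) u : Prop :=
  [/\ class_C12 u,
      exists M : R, forall (t : R) (x : 'rV[R]_n), 0 < t -> `|u t x| <= M,
      forall (t : R) (x : 'rV[R]_n), 0 < t -> dt u t x = laplacian u t x + f (u t x)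
    & forall K : set 'rV[R]_n, compact K ->
        L1_dist K (u t) u0 @[t --> 0^'+] --> 0%E].

Definition superlevel u (lambda t : R) : set 'rV[R]_n := [set x | lambda < u t x].

End solution.

Definition logistic {R : realType} (s : R) : R :=
  if (0 <= s <= 1) then s * (1 - s) else 0.

(** Minimal speed of the planar fronts connecting 1 to 0 for [logistic]:
    [2 * sqrt (f'(0))] with [f'(0) = 1]. *)
Definition cstar {R : realType} : R := 2.

Section spreading.
Context {R : realType} {n : nat}.
Implicit Types (U : set 'rV[R]_n) (u : R -> 'rV[R]_n -> R) (e : 'rV[R]_n).

Definition nonneg_unbounded_directions U e : set 'rV[R]_n :=
  [set xi | unbounded_directions U xi /\ 0 <= dot xi e].

Definition spreading_speed U e : \bar R :=
  if `[< unbounded_directions U e >] then +oo%E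
  else if `[< nonneg_unbounded_directions U e !=set0 >] then
    ereal_sup [set (cstar / Num.sqrt (1 - dot xi e ^+ 2))%:E
              | xi in nonneg_unbounded_directions U e]
  else cstar%:E.

Definition spreading_set U : set 'rV[R]_n :=
  [set x | exists e r, [/\ usphere e, 0 <= r, (r%:E < spreading_speed U e)%E
                         & x = r *: e]].

Definition property_i U u : Prop :=
  forall e, usphere e ->
    (forall c : R, 0 <= c -> (c%:E < spreading_speed U e)%E ->
       u t ((c * t) *: e) @[t --> +oo%R] --> (1 : R)) /\
    (forall c : R, (spreading_speed U e < c%:E)%E ->
       u t ((c * t) *: e) @[t --> +oo%R] --> (0 : R)).

(** Minima, maxima and suprema over nonempty sets are written as extended-real
    infima and suprema. *)
Definition property_ii U u : Prop :=
  forall e, usphere e ->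
    (forall c : R, 0 <= c -> (c%:E < spreading_speed U e)%E ->
       ereal_inf [set (u t ((s * t) *: e))%:E | s in [set s : R | 0 <= s <= c]]
         @[t --> +oo%R] --> 1%E) /\
    (forall c : R, (spreading_speed U e < c%:E)%E ->
       ereal_sup [set (u t ((s * t) *: e))%:E | s in [set s : R | c <= s]]
         @[t --> +oo%R] --> 0%E).

Definition property_iii U u : Prop :=
  forall C : set 'rV[R]_n, compact C -> C !=set0 ->
    (C `<=` spreading_set U ->
       ereal_inf [set (u t (t *: x))%:E | x in C] @[t --> +oo%R] --> 1%E) /\
    (C `<=` ~` closure (spreading_set U) ->
       ereal_sup [set (u t (t *: x))%:E | x in C] @[t --> +oo%R] --> 0%E).

Definition property_iv U u : Prop :=
  forall r lambda : R, 0 < r -> 0 < lambda < 1 ->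
    hausdorff (closure (eball 0 r) `&` scale_set t^-1 (superlevel u lambda t))
              (closure (eball 0 r) `&` spreading_set U)
      @[t --> +oo%R] --> 0%E.

Definition property_v U u : Prop :=
  forall lambda : R, 0 < lambda < 1 ->
    (hausdorff (superlevel u lambda t) (minkowski_sum U (eball 0 (cstar * t)))
       * (t^-1)%:E)%E @[t --> +oo%R] --> 0%E.

End spreading.

(** Points of [R^(m + 1) = R^m x R] are written [x = (x', x_N)] with
    [x' = lsubmx x] and [x_N = rsubmx x 0 0]. For [m = 0] the set is [[-1, 1]],
    hence bounded. *)
Definition gaussian_slab (R : realType) (m : nat) : set 'rV[R]_(m + 1) :=
  [set x | `|rsubmx x 0 0| <= expR (- enorm (lsubmx x) ^+ 2)].
Arguments gaussian_slab R m : clear implicits.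

(* Main.v *)
(** For [t > 0] the solution is smooth, so all the work is done by the maximum
    principle with explicit barriers.  The initial datum is only attained in
    [L^1_loc]; averaging [u] over small cubes turns this into locally uniform
    convergence, while the averages of [u] satisfy the same linear differential
    inequalities, and one recovers [u] by shrinking the cubes.

    Upper bound: [u] is a subsolution of [v_t = Lap v + v].  Cut [U] at
    [|x'| = k].  The bounded part is dominated by a plane wave
    [exp (k + 2 + 2 t - x.e)], the rest lies in a slab of width [exp (- k^2)] and is
    dominated by a one-dimensional heat kernel of mass of that order; the choice
    [k = a t] shows that [u -> 0] uniformly in [|x| >= c t] for every [c > 2].

    Lower bound: small exponentially weighted bumps moving with any velocity of
    modulus less than 2 are subsolutions, hence [u >= eps] in [|x| <= c t] for every
    [c < 2], and a paraboloid growing in time lifts [eps] to any level below 1.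

    So the superlevel sets rescale to the ball of radius 2, whereas [U] is
    unbounded in the horizontal directions, in which [w = +oo] and along which
    [U / t + B_2] fills the strip [|x_N| < 2]. *)

(* The nonlinearity does not commute with averaging. Hence only its linear consequences
   [0 <= logistic u] and [logistic u <= u] are used down to time 0; the nonlinear comparisons start
   at time 1 or later, where [u] is regular and a Gaussian lower bound (a bump of velocity x/t,
   which reaches x at time t) supplies a positive initial value. As [u] is bounded, adding a small
   strict supersolution that grows like |x|^2 confines a first contact to a compact set. The
   threshold 2 arises twice. From below, a bump of velocity b loses at rate |b|^2/4, up to an
   arbitrarily small error, against the growth rate 1 of the reaction near 0. From above, e^(-l x.e)
   with |e| = 1 travels at speed l + 1/l, which is minimal at l = 1. The Gaussian thinness matters:
   the reaction multiplies the far part of the slab by e^t at most, and e^(-(a t)^2) beats this for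
   every a > 0. With a thickness e^(-g |x'|) the same argument would require a > 1/g. *)
Require Import Defs.
From mathcomp Require Import all_boot all_order all_algebra.
From mathcomp Require Import all_classical all_reals all_analysis.
From mathcomp Require Import measurable_realfun ring lra.

Set Implicit Arguments.
Unset Strict Implicit.
Unset Printing Implicit Defensive.
Import Order.TTheory GRing.Theory Num.Theory.
Import numFieldNormedType.Exports.

Local Open Scope classical_set_scope.
Local Open Scope ring_scope.

(** * Lebesgue measure on tuples and averages over cubes *)

Section rV_norm.
Context {R : realType} {n : nat}.
Implicit Types x : 'rV[R]_n.

Lemma rV_norm_le x (e : R) : 0 <= e -> (forall i, `|x 0 i| <= e) -> `|x| <= e.
Proof.
move=> e0 xe; rewrite [leLHS]/Num.Def.normr /= mx_normrE.
by apply/bigmax_leP; split => // -[i j] _ /=; rewrite ord1.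
Qed.

Lemma coord_le_norm x i : `|x 0 i| <= `|x|.
Proof.
rewrite [leRHS]/Num.Def.normr /= mx_normrE.
by apply/bigmax_geP; right => /=; exists (0, i).
Qed.

End rV_norm.

Section tuple_shift.
Context {R : realType}.
Local Notation RT := (measurableTypeR R).

Lemma measurable_all_tnth n (P : 'I_n -> set RT) :
  (forall i, measurable (P i)) ->
  measurable [set v : n.-tuple RT | forall i, P i (tnth v i)].
Proof.
move=> mP.
rewrite (_ : [set _ | _] = \bigcap_(i in [set: 'I_n]) ((fun v => tnth v i) @^-1` P i)); last first.
  by apply/seteqP; split => v /= H i; [move=> _; exact: H|exact: H].
apply: fin_bigcap_measurable; first exact: finite_finset.
by move=> i _; rewrite -[X in measurable X]setTI; exact: measurable_tnth.
Qed.

(* Rounding the coordinates to the grid of mesh [1 / k.+1] takes countably many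
   values and converges to the identity. *)
Lemma continuous_measurable_row n (g : 'rV[R]_n -> R) : continuous g ->
  measurable_fun [set: n.-tuple RT] (g \o row_of_tuple).
Proof.
move=> cg.
pose rnd (k : nat) (v : n.-tuple RT) : 'rV[R]_n :=
  \row_i ((Num.floor ((tnth v i : R) * k.+1%:R))%:~R / k.+1%:R).
apply: (@measurable_fun_cvg _ _ _ _ (fun k => g \o rnd k)).
  move=> k _ Y mY; rewrite setTI.
  pose pt (z : 'rV[int]_n) : 'rV[R]_n := \row_i ((z 0 i)%:~R / k.+1%:R).
  rewrite (_ : _ @^-1` _ = \bigcup_(z in [set z | Y (g (pt z))])
     [set v : n.-tuple RT | forall i, [set r : RT | Num.floor ((r : R) * k.+1%:R) = z 0 i] (tnth v i)]); last first.
    apply/seteqP; split => v /=.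
      move=> Yv; exists (\row_i Num.floor ((tnth v i : R) * k.+1%:R)); last by move=> i; rewrite mxE.
      by congr (Y (g _)): Yv; apply/rowP => i; rewrite !mxE.
    by move=> [z Yz vz]; congr (Y (g _)): Yz; apply/rowP => i; rewrite !mxE vz.
  rewrite bigcup_mkcond; apply: countable_bigcupT_measurable => [|z]; first exact: countableP.
  case: ifP => _; last exact: measurable0.
  apply: (@measurable_all_tnth _ (fun i => [set r : RT | Num.floor ((r : R) * k.+1%:R) = z 0 i])) => i.
  rewrite (_ : [set _ | _] = `[((z 0 i)%:~R / k.+1%:R), ((z 0 i + 1)%:~R / k.+1%:R)[%classic); first exact: measurable_itv.
  apply/seteqP; split => r /=; rewrite in_itv /= ler_pdivrMr // ltr_pdivlMr //.
    by move=> <-; exact: Num.Theory.floor_itv.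
  exact: Num.Theory.floor_def.
move=> v _ /=.
apply: (@cvg_comp _ _ _ (fun k => rnd k v) g _ (nbhs (row_of_tuple v))); last exact: cg.
apply/cvgrPdist_le => e e0; near=> k.
apply: rV_norm_le => [|j]; first exact: ltW.
rewrite !mxE; apply: (@le_trans _ _ (k.+1%:R^-1 : R)); last first.
  by near: k; have := @near_infty_natSinv_lt R (PosNum e0); apply: filterS => k /ltW.
have k0 : (0 : R) < k.+1%:R by [].
have := Num.Theory.floor_itv ((tnth v j : R) * k.+1%:R); rewrite -ler_pdivrMr // -ltr_pdivlMr // intrD mulrDl mul1r.
move: (tnth v j : R) => r; move: (_ / _) => p.
have : (0 : R) <= k.+1%:R^-1 by [].
move: (k.+1%:R^-1) => q q0 /andP[pr rp]; rewrite ler_norml; apply/andP; split; lra.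
Unshelve. all: end_near.
Qed.

Lemma measurable_addl (a : R) :
  measurable_fun [set: RT] (fun r : RT => (a + (r : R) : RT)).
Proof. exact: measurable_funD. Qed.

Definition shift_tuple (a : nat -> R) n (v : n.-tuple RT) : n.-tuple RT :=
  [tuple (a i + (tnth v i : R) : RT) | i < n].

Arguments shift_tuple a {n} v.

Lemma measurable_shift_tuple a n :
  measurable_fun [set: n.-tuple RT] (@shift_tuple a n).
Proof.
apply/measurable_fun_tnthP => i.
rewrite (_ : _ \o _ = (fun r : R => a i + r) \o (fun v : n.-tuple RT => (tnth v i : R))); last first.
  by apply/funext => v /=; rewrite tnth_mktuple.
apply: measurableT_comp; last exact: measurable_tnth.
exact: measurable_funD.
Qed.

Lemma lebesgue_measure_shift (a : R) (A : set RT) : measurable A ->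
  lebesgue_measure ((fun r : RT => (a + (r : R) : RT)) @^-1` A) = lebesgue_measure A.
Proof.
move=> mA.
have mf := measurable_addl a.
transitivity (pushforward lebesgue_measure (fun r : RT => (a + (r : R) : RT)) A) => //.
apply/esym/lebesgue_measure_unique => //= _ [[x y]] _ <-; rewrite /pushforward.
rewrite (_ : _ @^-1` _ = `]x - a, y - a]%classic); last first.
  apply/seteqP; split => r /=; rewrite !in_itv /=; lra.
by rewrite !lebesgue_measure_itv /= !lte_fin ltrD2r -!EFinB opprB addrA subrK.
Qed.

Lemma shift_tuple_cons a n (x : RT) (v : n.-tuple RT) :
  shift_tuple a (cons_pair (x, v)) =
  cons_pair ((a 0 + (x : R) : RT), shift_tuple (a \o S) v).
Proof.
apply: eq_from_tnth => i; rewrite tnth_mktuple /cons_pair /=.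
case: (unliftP ord0 i) => [j|] ->; last by rewrite !tnth0.
by rewrite !tnthS tnth_mktuple.
Qed.

(** By induction on n: the shifted product measure agrees with the original one on rectangles, which
    determine it. The shift is indexed by [nat] so that the induction can pass from [a] to
    [a \o S]. *)
Lemma lebesgue_tuple_shift (a : nat -> R) n (A : set (n.-tuple RT)) :
  measurable A -> lebesgue_tuple R n (shift_tuple a @^-1` A) = lebesgue_tuple R n A.
Proof.
elim: n a A => [a A mA|n IH a A mA].
  suff -> : shift_tuple a @^-1` A = A by [].
  by rewrite (_ : shift_tuple a = id) //; apply/funext => v; rewrite [LHS]tuple0 [RHS]tuple0.
rewrite /= /cons_measure /pushforward.
pose f (p : RT * n.-tuple RT) : RT * n.-tuple RT :=
  ((a 0 + (p.1 : R) : RT), shift_tuple (a \o S) p.2).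
have mf : measurable_fun [set: RT * n.-tuple RT] f.
  apply/measurable_fun_pairP; split.
    exact: (measurableT_comp (measurable_addl (a 0)) measurable_fst).
  exact: (measurableT_comp (@measurable_shift_tuple (a \o S) n) measurable_snd).
rewrite (_ : @cons_pair _ RT n @^-1` _ = f @^-1` (@cons_pair _ RT n @^-1` A)); last first.
  by apply/seteqP; split => -[x v] /=; rewrite shift_tuple_cons.
have mB : measurable (@cons_pair _ RT n @^-1` A).
  by rewrite -[X in measurable X]setTI; exact: measurable_cons_pair.
transitivity (pushforward (lebesgue_measure \x lebesgue_tuple R n)%E f
  (@cons_pair _ RT n @^-1` A)) => //.
apply/esym/product_measure_unique => //= B C mB' mC; rewrite /pushforward.
rewrite (_ : _ @^-1` _ = ((fun r : RT => (a 0 + (r : R) : RT)) @^-1` B) `*`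
   (shift_tuple (a \o S) @^-1` C)); last by [].
rewrite product_measure1E.
- by rewrite IH //; congr (_ * _)%E; exact: lebesgue_measure_shift.
- rewrite -[X in measurable X]setTI; exact: measurable_addl.
- by rewrite -[X in measurable X]setTI; exact: measurable_shift_tuple.
Qed.

End tuple_shift.
Arguments shift_tuple {R} a {n} v.
Section tuple_cube.
Context {R : realType}.
Local Notation RT := (measurableTypeR R).

Definition tuple_cube n (h : R) : set (n.-tuple RT) :=
  [set v | forall i, `[0, h]%classic (tnth v i : R)].

Lemma measurable_tuple_cube n h : measurable (@tuple_cube n h).
Proof. exact: (@measurable_all_tnth _ _ (fun=> `[0, h]%classic)). Qed.

Lemma lebesgue_tuple_cube n (h : R) : 0 <= h ->
  lebesgue_tuple R n (tuple_cube h) = (h ^+ n)%:E.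
Proof.
move=> h0; elim: n => [|n IH].
  by rewrite /= diracE expr0 mem_set // => -[].
rewrite /= /cons_measure /pushforward.
rewrite (_ : @cons_pair _ RT n @^-1` _ = `[0, h]%classic `*` tuple_cube h).
  rewrite product_measure1E //; last exact: measurable_tuple_cube.
  have L : lebesgue_measure `[0, h]%classic = h%:E.
    rewrite lebesgue_measure_itv /= lte_fin; case: ltgtP h0 => // [h0 _|<- _] //.
    by rewrite -EFinB subr0.
  by rewrite exprS EFinM -IH; congr (_ * _)%E; exact: L.
apply/seteqP; split => -[x v] /=.
  by move=> H; split => [|i]; [have := H ord0; rewrite tnth0|have := H (lift ord0 i); rewrite tnthS].
by move=> [Hx Hv] i; case: (unliftP ord0 i) => [j|] ->; rewrite ?tnthS // tnth0.
Qed.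

(** The right-hand side does not depend on the shift: one L^1 bound on a large set B controls the
    integrals over all translated cubes contained in B. *)
Lemma le_integral_shift_cube n (a : nat -> R) (h : R) (B : set (n.-tuple RT))
    (g : n.-tuple RT -> \bar R) :
  measurable B -> measurable_fun B g -> (forall v, (0 <= g v)%E) ->
  tuple_cube h `<=` shift_tuple a @^-1` B ->
  (\int[lebesgue_tuple R n]_(v in tuple_cube h) g (shift_tuple a v) <=
   \int[lebesgue_tuple R n]_(v in B) g v)%E.
Proof.
move=> mB mg g0 hB.
have mS := @measurable_shift_tuple R a n.
have mSB : measurable (shift_tuple a @^-1` B).
  by rewrite -[X in measurable X]setTI; exact: mS.
have -> : (\int[lebesgue_tuple R n]_(v in B) g v =
  \int[pushforward (lebesgue_tuple R n) (shift_tuple a)]_(v in B) g v)%E.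
  by apply: eq_measure_integral => A mA _; rewrite /= /pushforward lebesgue_tuple_shift.
rewrite ge0_integral_pushforward //.
apply: ge0_subset_integral => //; first exact: measurable_tuple_cube.
by apply: (measurable_comp mB) => //; [move=> _ [v hv <-]|exact: measurable_funS mS].
Qed.

End tuple_cube.

Section cube_average.
Context {R : realType} {n : nat}.
Local Notation RT := (measurableTypeR R).
Implicit Types g : 'rV[R]_n -> R.

Definition row_cube (h : R) : set 'rV[R]_n := [set v | forall i, `[0, h]%classic (v 0 i)].

Lemma compact_row_cube h : compact (row_cube h).
Proof. by apply: (@rV_compact _ _ (fun=> `[0, h]%classic)) => _; exact: segment_compact. Qed.

Lemma row_of_tuple_cube h (v : n.-tuple RT) : tuple_cube h v <-> row_cube h (row_of_tuple v).
Proof. by split => H i; have := H i; rewrite mxE. Qed.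

Lemma continuous_cube_bounded g h : continuous g ->
  exists M, forall v, row_cube h v -> `|g v| <= M.
Proof.
move=> cg; have [M [_ HM]] : bounded_set (g @` row_cube h).
  apply: compact_bounded; apply: continuous_compact; last exact: compact_row_cube.
  exact: continuous_subspaceT.
exists (M + 1) => v hv; apply: (HM (M + 1)); first by rewrite ltrDl.
by exists v.
Qed.

Lemma integrable_cube g h : 0 <= h -> continuous g ->
  (lebesgue_tuple R n).-integrable (tuple_cube h) (EFin \o (g \o row_of_tuple)).
Proof.
move=> h0 cg; apply: measurable_bounded_integrable.
- exact: measurable_tuple_cube.
- by rewrite [X in (X < _)%E]lebesgue_tuple_cube // ltry.
- by apply: measurable_funTS; exact: continuous_measurable_row.
- have [M HM] := continuous_cube_bounded h cg.
  exists M; split; rewrite ?num_real // => r Mr v /row_of_tuple_cube hv /=.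
  by rewrite (le_trans (HM _ hv)) // ltW.
Qed.

Definition cube_average (h : R) g : R :=
  (h ^+ n)^-1 * \int[lebesgue_tuple R n]_(v in tuple_cube h) g (row_of_tuple v).

Lemma cube_average_cst h c : 0 < h -> cube_average h (fun=> c) = c.
Proof.
move=> h0; rewrite /cube_average Rintegral_cst; last exact: measurable_tuple_cube.
rewrite [X in fine X]lebesgue_tuple_cube 1?ltW //= mulrCA mulVf ?mulr1 //.
by rewrite expf_neq0 // gt_eqF.
Qed.

Lemma cube_averageD h g1 g2 : 0 < h -> continuous g1 -> continuous g2 ->
  cube_average h (fun v => g1 v + g2 v) = cube_average h g1 + cube_average h g2.
Proof.
move=> h0 c1 c2; rewrite /cube_average RintegralD ?mulrDr //;
  by [exact: measurable_tuple_cube|apply: integrable_cube => //; exact: ltW].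
Qed.

Lemma cube_averageB h g1 g2 : 0 < h -> continuous g1 -> continuous g2 ->
  cube_average h (fun v => g1 v - g2 v) = cube_average h g1 - cube_average h g2.
Proof.
move=> h0 c1 c2; rewrite /cube_average RintegralB ?mulrBr //;
  by [exact: measurable_tuple_cube|apply: integrable_cube => //; exact: ltW].
Qed.

Lemma cube_average_sum h (I : Type) (s : seq I) (g : I -> 'rV[R]_n -> R) : 0 < h ->
  (forall i, continuous (g i)) ->
  cube_average h (fun v => \sum_(i <- s) g i v) = \sum_(i <- s) cube_average h (g i).
Proof.
move=> h0 cg; elim: s => [|i s IH].
  rewrite big_nil -[RHS](cube_average_cst _ h0); congr cube_average.
  by apply/funext => v; rewrite big_nil.
rewrite big_cons -IH -cube_averageD //.
  by congr cube_average; apply/funext => v; rewrite big_cons.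
elim: s {IH} => [|j s IH] v.
  rewrite (_ : (fun _ => _) = fun=> 0); first exact: cst_continuous.
  by apply/funext => w; rewrite big_nil.
rewrite (_ : (fun _ => _) = g j \+ (fun w => \sum_(i0 <- s) g i0 w)).
  exact: (continuousD (cg j v) (IH v)).
by apply/funext => w; rewrite big_cons.
Qed.

Lemma le_cube_average h g1 g2 : 0 < h -> continuous g1 -> continuous g2 ->
  (forall v, row_cube h v -> g1 v <= g2 v) ->
  cube_average h g1 <= cube_average h g2.
Proof.
move=> h0 c1 c2 g12; apply: ler_wpM2l; first by rewrite invr_ge0 exprn_ge0 // ltW.
apply: le_Rintegral; first exact: measurable_tuple_cube.
- by apply: integrable_cube => //; exact: ltW.
- by apply: integrable_cube => //; exact: ltW.
- by move=> v /row_of_tuple_cube; exact: g12.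
Qed.

Lemma cube_average_dist h g1 g2 (d : R) : 0 < h -> continuous g1 -> continuous g2 ->
  (forall v, row_cube h v -> `|g1 v - g2 v| <= d) ->
  `|cube_average h g1 - cube_average h g2| <= d.
Proof.
move=> h0 c1 c2 gd; rewrite -cube_averageB // ler_norml.
have c12 : continuous (fun v => g1 v - g2 v) by move=> v; exact: (continuousB (c1 v) (c2 v)).
apply/andP; split.
- rewrite -[- d](cube_average_cst _ h0); apply: le_cube_average => //.
    exact: cst_continuous.
  by move=> v /gd; rewrite ler_norml => /andP[].
- rewrite -[d](cube_average_cst _ h0); apply: le_cube_average => //.
    exact: cst_continuous.
  by move=> v /gd; rewrite ler_norml => /andP[].
Qed.

(** Differentiation under the integral sign. The dominating function is a constant, a bound of |F'|
    on the compact product of [a - d/2, a + d/2] and the cube. *)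
Lemma is_derive_cube_average (F F' : R -> 'rV[R]_n -> R) (h a d : R) :
  0 < h -> 0 < d ->
  (forall s : R, a - d < s < a + d -> continuous (F s)) ->
  (forall (s : R) v, a - d < s < a + d -> is_derive s 1 (F ^~ v) (F' s v)) ->
  continuous (F' a) ->
  (forall (s : R) v, a - d < s < a + d ->
    {for (s, v), continuous (fun p : R * 'rV[R]_n => F' p.1 p.2)}) ->
  is_derive a 1 (fun s => cube_average h (F s)) (cube_average h (F' a)).
Proof.
move=> h0 d0 cF dF cF'a cF'.
have [M HM] : exists M : R, forall (s : R) v, a - d / 2 <= s <= a + d / 2 -> row_cube h v -> `|F' s v| <= M.
  have : compact ((fun p : R * 'rV[R]_n => F' p.1 p.2) @` (`[a - d / 2, a + d / 2]%classic `*` row_cube h)).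
    apply: continuous_compact; last by apply: compact_setX; [exact: segment_compact|exact: compact_row_cube].
    apply: continuous_in_subspaceT => -[s v]; rewrite inE /= in_itv /= => -[/andP[s1 s2] _].
    by apply: cF'; apply/andP; split; lra.
  move/compact_bounded => [M [_ HM]]; exists (M + 1) => s v sa hv.
  apply: (HM (M + 1)); first by rewrite ltrDl.
  by exists (s, v) => //; split => //=; rewrite in_itv.
have M0 : 0 <= M.
  apply: le_trans (HM a 0 _ _) => //; first by apply/andP; split; lra.
  by move=> i; rewrite /= in_itv /= mxE lexx ltW.
pose G s (v : n.-tuple RT) := F s (row_of_tuple v).
have inI s : `]a - d / 2, a + d / 2[%classic s -> a - d < s < a + d.
  by rewrite /= in_itv /= => /andP[? ?]; apply/andP; split; lra.
have Ia : `]a - d / 2, a + d / 2[%classic a by rewrite /= in_itv /=; apply/andP; split; lra.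
have intG (t : R) : `]a - d / 2, a + d / 2[%classic t ->
    (lebesgue_tuple R n).-integrable (tuple_cube h) (EFin \o G t).
  by move=> /inI /cF /(integrable_cube (ltW h0)).
have derG (t : R) y : `]a - d / 2, a + d / 2[%classic t -> tuple_cube h y -> derivable (G ^~ y) t 1.
  by move=> /inI xI _; have [] := dF t (row_of_tuple y) xI.
have intM : (lebesgue_tuple R n).-integrable (tuple_cube h) (EFin \o (fun=> M)).
  by have := @integrable_cube (fun=> M) h (ltW h0) (@cst_continuous _ _ M).
have G1 (t : R) y : `]a - d / 2, a + d / 2[%classic t -> partial1of2 G t y = F' t (row_of_tuple y).
  move=> xI; rewrite partial1of2E.
  by have := dF t (row_of_tuple y) (inI _ xI) => H; exact: derive_val.
have ubG (t : R) y : `]a - d / 2, a + d / 2[%classic t -> tuple_cube h y -> `|partial1of2 G t y| <= M.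
  move=> xI /row_of_tuple_cube hy; rewrite G1 //; apply: HM => //.
  by move: xI; rewrite /= in_itv /= => /andP[/ltW -> /ltW ->].
have mC := @measurable_tuple_cube R n h.
have D1 := derivable_under_integral mC Ia intG derG (fun=> M0) intM ubG.
have D2 := differentiation_under_integral mC Ia intG derG (fun=> M0) intM ubG.
rewrite /cube_average.
have -> : \int[lebesgue_tuple R n]_(v in tuple_cube h) F' a (row_of_tuple v) =
   'D_1 (fun s => \int[lebesgue_tuple R n]_(v in tuple_cube h) G s v) a.
  by rewrite -derive1E D2; apply: eq_Rintegral => y _; rewrite G1.
by have := derivableP D1; exact: is_deriveZ.
Qed.

End cube_average.

Lemma for_continuous_pair (T U V : topologicalType) (f : T -> U) (g : T -> V) (x : T) :
  {for x, continuous f} -> {for x, continuous g} -> {for x, continuous (fun y => (f y, g y))}.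
Proof. by move=> cf cg; exact: (cvg_pair cf cg). Qed.

Lemma for_continuous_fst (U V : topologicalType) (p : U * V) : {for p, continuous fst}.
Proof. exact: cvg_fst. Qed.

Lemma for_continuous_snd (U V : topologicalType) (p : U * V) : {for p, continuous snd}.
Proof. exact: cvg_snd. Qed.

Lemma for_continuous_id (T : topologicalType) (x : T) : {for x, continuous id}.
Proof. exact: cvg_id. Qed.

Lemma is_derive_translate {R : realType} (g : R -> R) (s a : R) :
  is_derive (0 : R) 1 g a -> is_derive s 1 (fun r => g (r - s)) a.
Proof.
move=> dg; rewrite -[a]mulr1; apply: (@is_derive1_comp _ g (fun r => r - s)).
  by rewrite subrr.
exact: is_derive_shift.
Qed.

(** * Regularity used by the maximum principle, and its inheritance by cube averages *)

Section parabolic.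
Context {R : realType} {n : nat}.
Implicit Types w : R -> 'rV[R]_n -> R.
Local Notation basis i := (delta_mx 0 i : 'rV[R]_n).

(* Space derivatives are taken along coordinate lines through the base point, so that
   only one-variable calculus is involved. *)
Record parabolic_regular w wt (w1 w2 : 'I_n -> R -> 'rV[R]_n -> R) : Prop := {
  pr_cont : pos_continuous w;
  pr_dt : forall (t : R) (x : 'rV[R]_n), 0 < t -> is_derive t 1 (w ^~ x) (wt t x);
  pr_dx : forall i (t : R) (x : 'rV[R]_n), 0 < t ->
    is_derive (0 : R) 1 (fun s : R => w t (x + s *: basis i)) (w1 i t x);
  pr_dxx : forall i (t : R) (x : 'rV[R]_n), 0 < t ->
    is_derive (0 : R) 1 (fun s : R => w1 i t (x + s *: basis i)) (w2 i t x) }.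

Lemma is_derive_line (g : 'rV[R]_n -> R) (x e : 'rV[R]_n) : derivable g x e ->
  is_derive (0 : R) 1 (fun s : R => g (x + s *: e)) ('D_e g x).
Proof.
move=> dg; rewrite (_ : (fun s => _) = (fun s => g (s *: e + x))); last first.
  by apply/funext => s; rewrite addrC.
apply: (@DeriveDef _ _ _ _ _ _ _ ((derivable1P g x e).1 dg)).
rewrite /derive; set g1 := fun h => h^-1 *: _; set g2 := fun h => h^-1 *: _.
suff -> : g1 = g2 by []; apply/funext => h; rewrite /g1 /g2 /=.
by rewrite addr0 scale0r add0r [_%:A]mulr1.
Qed.

Lemma class_C12_parabolic (u : R -> 'rV[R]_n -> R) : class_C12 u ->
  parabolic_regular u (dt u) (fun i => dx i u) (fun i => dx i (dx i u)).
Proof.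
move=> [cu [du _] d1 d2]; split.
- exact: cu.
- by move=> t x t0; rewrite /dt derive1E; exact: (derivableP (du t x t0)).
- by move=> i t x t0; apply: is_derive_line; exact: (d1 i).1.
- by move=> i t x t0; apply: is_derive_line; exact: (d2 i i).1.
Qed.

Lemma continuous_addl (x : 'rV[R]_n) : continuous (fun v => x + v).
Proof.
by move=> v; exact: (continuousD (@cst_continuous _ _ x v) (@for_continuous_id _ v)).
Qed.

Lemma pos_continuous_row w (t : R) (x : 'rV[R]_n) :
  pos_continuous w -> 0 < t -> continuous (fun v => w t (x + v)).
Proof.
move=> cw t0 v; have c1 := for_continuous_pair (@cst_continuous _ _ t v) (@continuous_addl x v).
exact: (continuous_comp c1 (cw _ (x + v) t0)).
Qed.

(** Compactness of the cube makes joint continuity uniform in v, and uniform estimates pass to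
    averages. *)
Lemma near_row_cube w (h t : R) (x : 'rV[R]_n) (e : R) : pos_continuous w -> 0 < t -> 0 < e ->
  \forall p \near (t, x), forall v, row_cube h v -> `|w p.1 (p.2 + v) - w t (x + v)| <= e.
Proof.
move=> cw t0 e0.
have /compact_near_coveringP H := @compact_row_cube R n h.
apply: (H _ (nbhs (t, x)) (fun p v => `|w p.1 (p.2 + v) - w t (x + v)| <= e)) => v0 hv0.
pose z0 := (v0, (t, x)).
have cz1 : {for z0, continuous (fun q : 'rV[R]_n * (R * 'rV[R]_n) => q.2.1)}.
  exact: (continuous_comp (@for_continuous_snd _ _ z0) (@for_continuous_fst _ _ _)).
have cz2 : {for z0, continuous (fun q : 'rV[R]_n * (R * 'rV[R]_n) => q.2.2)}.
  exact: (continuous_comp (@for_continuous_snd _ _ z0) (@for_continuous_snd _ _ _)).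
have cz3 := continuousD cz2 (@for_continuous_fst _ _ z0).
have c1 : {for z0, continuous (fun q : 'rV[R]_n * (R * 'rV[R]_n) => w q.2.1 (q.2.2 + q.1))}.
  exact: (continuous_comp (for_continuous_pair cz1 cz3) (cw t (x + v0) t0)).
have c2 : {for z0, continuous (fun q : 'rV[R]_n * (R * 'rV[R]_n) => w t (x + q.1))}.
  exact: (continuous_comp (@for_continuous_fst _ _ z0) (@pos_continuous_row w t x cw t0 v0)).
have e20 : 0 < e / 2 by rewrite divr_gt0.
move/cvgrPdist_le : c1 => /(_ _ e20) c1; move/cvgrPdist_le : c2 => /(_ _ e20) c2.
near=> q.
have -> : w q.2.1 (q.2.2 + q.1) - w t (x + q.1) =
  (w t (x + v0) - w t (x + q.1)) - (w t (x + v0) - w q.2.1 (q.2.2 + q.1)) by ring.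
rewrite (le_trans (ler_normB _ _)) // (splitr e) lerD //.
  by near: q; exact: c2.
by near: q; exact: c1.
Unshelve. all: end_near. Qed.

Definition space_average (h : R) w : R -> 'rV[R]_n -> R :=
  fun t x => cube_average h (fun v => w t (x + v)).

Lemma pos_continuous_average h w : 0 < h -> pos_continuous w ->
  pos_continuous (space_average h w).
Proof.
move=> h0 cw t x t0; apply/cvgrPdist_le => /= e e0.
near=> p; rewrite distrC; apply: cube_average_dist => //.
- apply: pos_continuous_row => //; near: p.
  have : \forall s \near t, 0 < s by exact: lt_nbhsr.
  by apply: cvg_fst.
- exact: pos_continuous_row.
- by near: p; exact: near_row_cube.
Unshelve. all: end_near. Qed.

Lemma is_derive_average_line (w w' : R -> 'rV[R]_n -> R) (h t : R) (x e : 'rV[R]_n) :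
  0 < h -> 0 < t -> pos_continuous w -> pos_continuous w' ->
  (forall y, is_derive (0 : R) 1 (fun s : R => w t (y + s *: e)) (w' t y)) ->
  is_derive (0 : R) 1 (fun s : R => space_average h w t (x + s *: e)) (space_average h w' t x).
Proof.
move=> h0 t0 cw cw' dw; rewrite /space_average.
pose F' (s : R) v := w' t (x + s *: e + v).
have -> : (fun v => w' t (x + v)) = F' 0.
  by apply/funext => v; rewrite /F' scale0r addr0.
apply: (@is_derive_cube_average _ _ (fun s v => w t (x + s *: e + v)) F' h 0 1) => //.
- by move=> s _; exact: pos_continuous_row.
- move=> s v _; have := dw (x + s *: e + v).
  move/(is_derive_translate s); congr (is_derive s 1 _ _); apply/funext => r.
  by rewrite scalerBl addrAC -[x + _ + (_ - _)]addrA [s *: e + _]addrC subrK.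
- exact: pos_continuous_row.
- move=> s v _.
  have c1 := continuous_comp (@for_continuous_fst _ _ (s, v)) (@scalel_continuous _ _ e s).
  have c2 := continuousD (@cst_continuous _ _ x (s, v)) c1.
  have c3 := continuousD c2 (@for_continuous_snd _ _ (s, v)).
  exact: (continuous_comp (for_continuous_pair (@cst_continuous _ _ t (s, v)) c3) (cw' t (x + s *: e + v) t0)).
Qed.

Lemma parabolic_regular_average (h : R) w wt (w1 w2 : 'I_n -> R -> 'rV[R]_n -> R) : 0 < h ->
  parabolic_regular w wt w1 w2 -> pos_continuous wt ->
  (forall i, pos_continuous (w1 i)) -> (forall i, pos_continuous (w2 i)) ->
  parabolic_regular (space_average h w) (space_average h wt)
    (fun i => space_average h (w1 i)) (fun i => space_average h (w2 i)).
Proof.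
move=> h0 [cw dw d1 d2] cwt cw1 cw2; split.
- exact: pos_continuous_average.
- move=> t x t0; rewrite /space_average.
  apply: (@is_derive_cube_average _ _ (fun s v => w s (x + v)) (fun s v => wt s (x + v)) h t t) => //.
  + by move=> s /andP[s0 _]; apply: pos_continuous_row => //; move: s0; rewrite subrr.
  + by move=> s v /andP[s0 _]; apply: dw; move: s0; rewrite subrr.
  + exact: pos_continuous_row.
  + move=> s v /andP[]; rewrite subrr => s0 _.
    exact: (continuous_comp (for_continuous_pair (@for_continuous_fst _ _ (s, v))
      (continuous_comp (@for_continuous_snd _ _ (s, v)) (@continuous_addl x v))) (cwt s (x + v) s0)).
- by move=> i t x t0; apply: is_derive_average_line => // y; exact: d1.
- by move=> i t x t0; apply: is_derive_average_line => // y; exact: d2.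
Qed.

End parabolic.

(** * The maximum principle *)

Section minimum_tests.
Context {R : realType}.

Lemma is_derive_quotient (g : R -> R) (a d e : R) : is_derive a 1 g d -> 0 < e ->
  exists2 r : R, 0 < r & forall h, h != 0 -> `|h| < r ->
    `|h^-1 * (g (a + h) - g a) - d| < e.
Proof.
move=> dg e0; have dga : derivable g a 1 by [].
have gd : h^-1 *: (g (h *: 1 + a) - g a) @[h --> (0 : R)^'] --> d.
  by have /cvg_ex[l Hl] := dga; have <- := @derive_val _ _ _ _ _ _ _ dg; exact: dga.
move/cvgrPdist_lt : gd => /(_ e e0); rewrite /dnbhs near_withinE => /nbhs_ballP[r /= r0 Hr].
exists r => // h hn0 hr; rewrite distrC; have := Hr h.
rewrite /ball /= sub0r normrN => /(_ hr hn0).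
by rewrite [_%:A]mulr1 [h + a]addrC.
Qed.

(** If p < 0, then g1, which vanishes at the minimum 0, is negative just to its right, and the mean
    value theorem yields a value of g below g 0. *)
Lemma second_derivative_ge0 (g g1 : R -> R) (p : R) :
  (forall s : R, is_derive s 1 g (g1 s)) -> is_derive (0 : R) 1 g1 p ->
  (forall s, g 0 <= g s) -> 0 <= p.
Proof.
move=> dg dg1 gmin.
have g10 : g1 0 = 0.
  have D : is_derive (0 : R) 1 g 0.
    apply: (@derive1_at_min _ g (-1) 1) => //; rewrite ?in_itv /=; lra.
  have <- := @derive_val _ _ _ _ _ _ _ (dg 0).
  exact: (@derive_val _ _ _ _ _ _ _ D).
rewrite leNgt; apply/negP => p0.
have [|r r0 Hr] := is_derive_quotient dg1 (_ : 0 < - p); first by rewrite oppr_gt0.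
have r20 : 0 < r / 2 by rewrite divr_gt0.
have cg : {within `[0, r / 2], continuous g}.
  by apply: derivable_within_continuous => x _; have [] := dg x.
have [c c01 gc] := MVT r20 (fun x _ => dg x) cg.
move: c01; rewrite in_itv /= => /andP[c0 cr].
have := Hr c; rewrite gt_eqF // gtr0_norm // add0r g10 subr0 => /(_ isT) H.
have {}H : c^-1 * g1 c < 0 by have := H (ltac:(lra)); rewrite ltr_norml => /andP[_]; lra.
have g1c : g1 c < 0 by move: H; rewrite pmulr_rlt0 // invr_gt0.
have : g1 c * (r / 2 - 0) < 0 by rewrite subr0 nmulr_rlt0.
by rewrite -gc subr_lt0 ltNge gmin.
Qed.

(** At a first contact only earlier times are under control, hence difference quotients with
    negative increment. *)
Lemma left_derivative_le0 (g : R -> R) (a t d : R) : a < t -> is_derive t 1 g d ->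
  (forall s : R, a <= s <= t -> g t <= g s) -> d <= 0.
Proof.
move=> at_ dg gmin; rewrite leNgt; apply/negP => d0.
have [r r0 Hr] := is_derive_quotient dg d0.
pose h := Num.min (r / 2) (t - a).
have h0 : 0 < h by rewrite lt_min subr_gt0 at_ andbT divr_gt0.
have hr : h <= r / 2 by rewrite ge_min lexx.
have ha : h <= t - a by rewrite ge_min lexx orbT.
have := Hr (- h); rewrite oppr_eq0 gt_eqF // normrN gtr0_norm // => /(_ isT) H.
have /gmin : a <= t - h <= t by apply/andP; split; lra.
rewrite -subr_ge0 => gh.
have {}hr : h < r by lra.
move: (H hr).
rewrite invrN mulNr ltr_norml => /andP[+ _].
have : 0 <= h^-1 * (g (t - h) - g t) by rewrite mulr_ge0 // invr_ge0 ltW.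
lra.
Qed.
End minimum_tests.

Section comparison.
Context {R : realType} {n : nat}.
Implicit Types w : R -> 'rV[R]_n -> R.

(** Positivity for |x| > r makes the set of points with w <= 0 and time in [T0, T1] compact; a point
    of least time in it is the first zero. *)
Lemma first_zero w (T0 T1 r : R) : 0 < T0 -> pos_continuous w ->
  (forall x, 0 < w T0 x) ->
  (forall t x, T0 <= t <= T1 -> r < `|x| -> 0 < w t x) ->
  (exists t x, T0 <= t <= T1 /\ w t x <= 0) ->
  exists t x, [/\ T0 < t <= T1, w t x = 0 & forall s y, T0 <= s <= t -> 0 <= w s y].
Proof.
move=> T00 cw w0 wr [t1 [x1 [t1T wt1]]].
(* Freezing the time before T0 gives a function continuous everywhere, whereas w is controlled at
   positive times only. *)
pose v (p : R * 'rV[R]_n) := w (Num.max p.1 T0) p.2.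
have cv : continuous v.
  move=> p; have c1 := for_continuous_pair
    (continuous_max (@for_continuous_fst _ _ p) (@cst_continuous _ _ T0 p)) (@for_continuous_snd _ _ p).
  apply: (continuous_comp c1 (cw _ p.2 _)).
  by rewrite lt_max T00 orbT.
pose K := `[T0, T1]%classic `*` [set x : 'rV[R]_n | forall i, `[- r, r]%classic (x 0 i)].
have cK : compact K.
  apply: compact_setX; first exact: segment_compact.
  by apply: (@rV_compact _ _ (fun=> `[- r, r]%classic)) => _; exact: segment_compact.
pose Z := K `&` v @^-1` [set y | y <= 0].
have cZ : compact Z.
  apply: compact_closedI => //.
  by apply: closed_comp; [move=> p _; exact: cv|exact: closed_le].
have inZ t x : T0 <= t <= T1 -> w t x <= 0 -> Z (t, x).
  move=> tT wtx; split; last by rewrite /v /= max_l //; case/andP: tT.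
  split; first by rewrite /= in_itv.
  have xr : `|x| <= r by rewrite leNgt; apply/negP => /(wr _ _ tT); rewrite ltNge wtx.
  move=> i; rewrite /= in_itv /= -ler_norml.
  exact: le_trans (coord_le_norm x i) xr.
have Z0 : Z !=set0 by exists (t1, x1); exact: inZ.
have [t [x [Ztx tmin]]] : exists (t : R) x, Z (t, x) /\ forall s y, Z (s, y) -> t <= s.
  have cf : {within Z, continuous fst}.
    by apply: continuous_subspaceT => p; exact: for_continuous_fst.
  have [[t x] /set_mem Ztx tmin] := compact_EVT_min Z0 cZ cf.
  by exists t, x; split => // s y Zsy; apply: (tmin (s, y)); rewrite inE.
have [[/= tT _] vtx] := Ztx; move: tT; rewrite in_itv /= => tT.
have {}vtx : w t x <= 0 by move: vtx; rewrite /v /= max_l //; case/andP: tT.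
have T0t : T0 < t.
  rewrite lt_neqAle (andP tT).1 andbT; apply/eqP => E.
  by move: (w0 x); rewrite E ltNge vtx.
have wpos s y : T0 <= s < t -> 0 < w s y.
  move=> /andP[T0s st]; rewrite ltNge; apply/negP => wsy.
  suff /(lt_le_trans st) : t <= s by rewrite ltxx.
  by apply: (tmin s y); apply: inZ => //; rewrite T0s /= (le_trans (ltW st)) //; case/andP: tT.
have t0 : 0 < t by exact: lt_trans T0t.
(* At time t itself the sign follows by continuity: a negative value at (t, y) would persist at
   slightly earlier times, against [wpos]. *)
have wge s y : T0 <= s <= t -> 0 <= w s y.
  move=> /andP[T0s]; rewrite le_eqVlt => /predU1P[->|st]; last by apply/ltW/wpos; rewrite T0s.
  rewrite leNgt; apply/negP => wty.
  have : (fun s' => w s' y) s' @[s' --> t] --> w t y.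
    exact: (continuous_comp (for_continuous_pair (@for_continuous_id _ t) (@cst_continuous _ _ y t)) (cw t y t0)).
  move/cvgrPdist_lt => /(_ (- w t y)); rewrite oppr_gt0 => /(_ wty) /nbhs_ballP[d /= d0 Hd].
  pose s' := Num.max T0 (t - d / 2).
  have s't : s' < t by rewrite gt_max T0t /=; lra.
  have T0s' : T0 <= s' by rewrite le_max lexx.
  have s'd : t - d / 2 <= s' by rewrite le_max lexx orbT.
  have := Hd s'; rewrite /ball /= ltr_norml => /(_ _)/wrap[]; first by apply/andP; split; lra.
  have := wpos s' y; rewrite T0s' s't => /(_ isT) H.
  by rewrite ltr_norml => /andP[]; lra.
exists t, x; split => //; first by rewrite T0t; case/andP: tT.
by apply/eqP; rewrite eq_le vtx wge // lexx ltW.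
Qed.

(** No equation is fixed: it enters only through [touch], which has to be refuted at a first
    contact. The same statement thus serves linear and nonlinear comparisons, and barriers that are
    subsolutions only where they are positive. *)
Lemma comparison_gt0 w wt (w1 w2 : 'I_n -> R -> 'rV[R]_n -> R) (T0 T1 r : R) :
  0 < T0 -> parabolic_regular w wt w1 w2 ->
  (forall x, 0 < w T0 x) ->
  (forall t x, T0 <= t <= T1 -> r < `|x| -> 0 < w t x) ->
  (forall t x, T0 < t <= T1 -> w t x = 0 -> wt t x <= 0 ->
     (forall i, 0 <= w2 i t x) -> False) ->
  forall t x, T0 <= t <= T1 -> 0 < w t x.
Proof.
move=> T00 [cw dwt dw1 dw2] w0 wr touch t1 x1 t1T; rewrite ltNge; apply/negP => w1le.
have [|t [x [/andP[T0t tT] wtx wpos]]] := first_zero T00 cw w0 wr; first by exists t1, x1.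
have t0 : 0 < t by exact: lt_trans T0t.
apply: (touch t x) => //; first by rewrite T0t.
- by apply: (left_derivative_le0 T0t (dwt t x t0)) => s sT; rewrite wtx wpos.
- move=> i; pose e : 'rV[R]_n := delta_mx 0 i.
  apply: (@second_derivative_ge0 _ (fun s => w t (x + s *: e)) (fun s => w1 i t (x + s *: e))).
  + move=> s; have := is_derive_translate s (dw1 i t (x + s *: e) t0).
    congr (is_derive s 1 _ _); apply/funext => q.
    by rewrite -/e -addrA -scalerDl [s + _]addrC subrK.
  + exact: dw2.
  + by move=> s; rewrite scale0r addr0 wtx wpos // lexx ltW.
Qed.
End comparison.

Lemma cvge0_near_lt {R : realType} {T : Type} {F : set_system T} {FF : Filter F}
    (f : T -> \bar R) (e : R) : f @ F --> 0%E -> 0 < e -> \forall x \near F, (f x < e%:E)%E.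
Proof.
move=> /fine_cvgP[ffin /cvgrPdist_lt H] e0; near=> x.
have fx : f x \is a fin_num by near: x.
rewrite -(fineK fx) lte_fin; apply: le_lt_trans (ler_norm _) _.
by rewrite -normrN -sub0r; near: x; exact: H.
Unshelve. all: end_near. Qed.

Lemma at_right0_ex {R : realType} (P : R -> Prop) : (\forall t \near (0 : R)^'+, P t) ->
  exists2 d : R, 0 < d & forall t, 0 < t < d -> P t.
Proof.
rewrite /at_right near_withinE => /nbhs_ballP[d /= d0 H]; exists d => // t /andP[t0 td].
by apply: H => //; rewrite /ball /= sub0r normrN gtr0_norm.
Qed.

Section initial_data.
Context {R : realType} {n : nat}.
Local Notation RT := (measurableTypeR R).
Implicit Types w : R -> 'rV[R]_n -> R.

Lemma cvg_space_average w (t : R) (x : 'rV[R]_n) (e : R) : pos_continuous w -> 0 < t -> 0 < e ->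
  exists2 h0 : R, 0 < h0 & forall h, 0 < h <= h0 -> `|space_average h w t x - w t x| <= e.
Proof.
move=> cw t0 e0.
have := @pos_continuous_row _ _ _ t x cw t0 0.
move/cvgrPdist_le => /(_ _ e0) /nbhs_ballP[d /= d0 Hd].
exists (d / 2) => [|h /andP[h0 hd]]; first by rewrite divr_gt0.
rewrite -[X in _ - X](@cube_average_cst _ n h (w t x) h0).
apply: cube_average_dist => //; first exact: pos_continuous_row.
  exact: cst_continuous.
move=> v hv; have := Hd v; rewrite addr0 distrC; apply.
rewrite -ball_normE /= sub0r normrN; apply: le_lt_trans (_ : d / 2 < d); last lra.
apply: rV_norm_le => [|i]; first by rewrite divr_ge0 // ltW.
have := hv i; rewrite /= in_itv /= => /andP[v0 vh].
by rewrite ger0_norm //; exact: le_trans hd.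
Qed.

(* Extended by 0, so that translations of [n]-tuples can be defined by recursion on [n]. *)
Definition nat_coord (x : 'rV[R]_n) (k : nat) : R := if insub k is Some i then x 0 i else 0.

Lemma row_of_tuple_shift (x : 'rV[R]_n) (v : n.-tuple RT) :
  row_of_tuple (shift_tuple (nat_coord x) v) = x + row_of_tuple v.
Proof. by apply/rowP => i; rewrite !mxE tnth_mktuple /nat_coord valK. Qed.

(** The time d is uniform in |x| <= r because all the cubes x + [0, h]^n lie in one compact set K,
    on which u t is L^1-close to u0. *)
Lemma space_average_initial (u : R -> 'rV[R]_n -> R) (u0 : 'rV[R]_n -> R) (h r e : R) :
  pos_continuous u -> measurable_fun [set: n.-tuple RT] (u0 \o row_of_tuple) ->
  (forall K : set 'rV[R]_n, compact K -> L1_dist K (u t) u0 @[t --> 0^'+] --> 0%E) ->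
  0 < h -> 0 < e ->
  exists2 d : R, 0 < d & forall t x c, 0 < t < d -> `|x| <= r ->
   (forall v, row_cube h v -> c <= u0 (x + v)) ->
   c - e <= space_average h u t x.
Proof.
move=> cu mu0 L1 h0 e0.
pose K : set 'rV[R]_n := [set y | forall i, `[- (r + h), r + h]%classic (y 0 i)].
have cK : compact K.
  by apply: (@rV_compact _ _ (fun=> `[- (r + h), r + h]%classic)) => _; exact: segment_compact.
have mK : measurable (@row_of_tuple R n @^-1` K).
  have -> : @row_of_tuple R n @^-1` K = [set v : n.-tuple RT | forall i, `[- (r + h), r + h]%classic (tnth v i : R)].
    by apply/seteqP; split => v H i; have := H i; rewrite mxE.
  exact: (@measurable_all_tnth _ _ (fun=> `[- (r + h), r + h]%classic)).
have hn0 : 0 < h ^+ n by rewrite exprn_gt0.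
(* Averaging divides by h^n, so an L^1 error e h^n becomes an error e. *)
have eh0 : 0 < e * h ^+ n by rewrite mulr_gt0.
have [d d0 Hd] := at_right0_ex (cvge0_near_lt (L1 K cK) eh0).
exists d => // t x c td xr c1.
have t0 : 0 < t by case/andP: td.
have mu : measurable_fun [set: n.-tuple RT] (u t \o row_of_tuple).
  apply: continuous_measurable_row => y.
  by have := @pos_continuous_row _ _ _ t 0 cu t0 y; under eq_fun do rewrite add0r.
pose D (v : n.-tuple RT) : R := `|u t (row_of_tuple v) - u0 (row_of_tuple v)|.
have mD : measurable_fun [set: n.-tuple RT] D.
  by apply: measurableT_comp => //; exact: measurable_funB.
pose DS v := D (shift_tuple (nat_coord x) v).
have mDS : measurable_fun [set: n.-tuple RT] DS.
  by apply: measurableT_comp => //; exact: measurable_shift_tuple.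
have mC := @measurable_tuple_cube R n h.
have IDS : (\int[lebesgue_tuple R n]_(v in tuple_cube h) (DS v)%:E < (e * h ^+ n)%:E)%E.
  apply: le_lt_trans (Hd t td).
  apply: (@le_integral_shift_cube _ _ (nat_coord x) h _ (fun v => (D v)%:E)) => //.
  - by apply/measurable_EFinP; exact: measurable_funTS.
  - by move=> v; rewrite lee_fin normr_ge0.
  move=> v hv i; rewrite row_of_tuple_shift !mxE /= in_itv /= -ler_norml.
  apply: le_trans (ler_normD _ _) _; apply: lerD.
    exact: le_trans (coord_le_norm x i) xr.
  have := hv i; rewrite /= in_itv /= => /andP[v0 vh]; by rewrite ger0_norm.
have iDS : (lebesgue_tuple R n).-integrable (tuple_cube h) (EFin \o DS).
  apply/integrableP; split; first by apply/measurable_EFinP; exact: measurable_funTS.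
  under eq_integral do rewrite /= normr_id.
  exact: lt_trans IDS (ltry _).
have RDS : \int[lebesgue_tuple R n]_(v in tuple_cube h) DS v <= e * h ^+ n.
  rewrite -lee_fin fineK; first exact: ltW.
  exact: integrable_fin_num.
have cux : continuous (fun v => u t (x + v)) by exact: pos_continuous_row.
have iu := integrable_cube (ltW h0) cux.
have ic := integrable_cube (ltW h0) (@cst_continuous 'rV[R]_n _ c).
have Dc v : tuple_cube h v -> c - DS v <= u t (x + row_of_tuple v).
  move=> /row_of_tuple_cube /c1; rewrite /DS /D row_of_tuple_shift.
  have := ler_norm (- (u t (x + row_of_tuple v) - u0 (x + row_of_tuple v))); rewrite normrN.
  by move=> H1 H3; lra.
have cE : \int[lebesgue_tuple R n]_(v in tuple_cube h) c = c * h ^+ n.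
  by rewrite Rintegral_cst //; congr (_ * _); rewrite [X in fine X]lebesgue_tuple_cube // ltW.
have hK : h ^- n * ((c - e) * h ^+ n) = c - e by rewrite mulrCA mulVf ?mulr1 // gt_eqF.
rewrite /space_average /cube_average -[c - e]hK.
apply: ler_wpM2l; first by rewrite invr_ge0 ltW.
apply: (@le_trans _ _ (\int[lebesgue_tuple R n]_(v in tuple_cube h) (c - DS v))).
  have -> := RintegralB mC ic iDS.
  by rewrite [X in _ <= X - _]cE mulrBl lerB.
by apply: le_Rintegral => //; exact: (integrableB mC ic iDS).
Qed.

End initial_data.

(** * Calculus for explicit barriers *)

Section derivatives.
Context {R : realType}.
Implicit Types (f g : R -> R) (s a b c : R).

Lemma is_derive_cst1 s c : is_derive s 1 (fun=> c) 0.
Proof. exact: is_derive_cst. Qed.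

Lemma is_derive_id1 s : is_derive s 1 (fun r : R => r) 1.
Proof. exact: is_derive_id. Qed.

Lemma is_derive_add f g s a b : is_derive s 1 f a -> is_derive s 1 g b ->
  is_derive s 1 (fun r => f r + g r) (a + b).
Proof. exact: is_deriveD. Qed.

Lemma is_derive_opp f s a : is_derive s 1 f a -> is_derive s 1 (fun r => - f r) (- a).
Proof. exact: is_deriveN. Qed.

Lemma is_derive_mul f g s a b : is_derive s 1 f a -> is_derive s 1 g b ->
  is_derive s 1 (fun r => f r * g r) (f s * b + g s * a).
Proof. exact: is_deriveM. Qed.

Lemma is_derive_exp f s a : is_derive s 1 f a ->
  is_derive s 1 (fun r => expR (f r)) (expR (f s) * a).
Proof. exact: is_derive1_comp. Qed.

Lemma is_derive_ln f s a : 0 < f s -> is_derive s 1 f a ->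
  is_derive s 1 (fun r => ln (f r)) ((f s)^-1 * a).
Proof. by move=> fs; apply: (@is_derive1_comp _ _ f); exact: is_derive1_ln. Qed.

Lemma is_derive_inv f s a : f s != 0 -> is_derive s 1 f a ->
  is_derive s 1 (fun r => (f r)^-1) (- (f s) ^- 2 * a).
Proof. by move=> fs df; exact: is_deriveV. Qed.

Lemma is_derive_pow f n s a : is_derive s 1 f a ->
  is_derive s 1 (fun r => f r ^+ n.+1) ((n.+1%:R * f s ^+ n) * a).
Proof. by move=> df; rewrite -(exprfctE f n.+1); exact: is_deriveX. Qed.

Lemma is_derive_val f s a b : is_derive s 1 f a -> a = b -> is_derive s 1 f b.
Proof. by move=> df <-. Qed.

End derivatives.

(** [is_derive] is a class, so instance search is kept away from the subgoals: the derivative is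
    built structurally and compared with the expected one at the end. *)
Ltac derive_step := first
  [ notypeclasses refine (is_derive_cst1 _ _)
  | notypeclasses refine (is_derive_id1 _)
  | notypeclasses refine (is_derive_add _ _)
  | notypeclasses refine (is_derive_opp _)
  | notypeclasses refine (is_derive_exp _)
  | notypeclasses refine (is_derive_pow _ _)
  | notypeclasses refine (is_derive_mul _ _) ].
Ltac derive := notypeclasses refine (is_derive_val _ _); [repeat derive_step | cbv beta; cbv delta [Datatypes.id]; cbv beta].

Section continuity.
Context {R : realType} {T : topologicalType}.
Implicit Types (f g : T -> R) (x : T).

(* A constant, unlike [{for x, continuous f}], on which the tactic [cont] can match. *)
Definition cont_at x f : Prop := {for x, continuous f}.

Lemma cont_at_cst x (c : R) : cont_at x (fun=> c).
Proof. exact: cst_continuous. Qed.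

Lemma cont_at_add f g x : cont_at x f -> cont_at x g ->
  cont_at x (fun y => f y + g y).
Proof. exact: continuousD. Qed.

Lemma cont_at_opp f x : cont_at x f -> cont_at x (fun y => - f y).
Proof. exact: continuousN. Qed.

Lemma cont_at_mul f g x : cont_at x f -> cont_at x g ->
  cont_at x (fun y => f y * g y).
Proof. exact: continuousM. Qed.

Lemma cont_at_pow f n x : cont_at x f -> cont_at x (fun y => f y ^+ n).
Proof.
move=> cf; elim: n => [|n IH]; first exact: cst_continuous.
rewrite (_ : (fun y => _) = fun y => f y * f y ^+ n); first exact: cont_at_mul.
by apply/funext => y; rewrite exprS.
Qed.

Lemma cont_at_exp f x : cont_at x f -> cont_at x (fun y => expR (f y)).
Proof. by move=> cf; exact: (continuous_comp (cf : {for x, continuous f}) (@continuous_expR R (f x))). Qed.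

Lemma cont_at_sum (I : Type) (r : seq I) (f : I -> T -> R) x :
  (forall i, cont_at x (f i)) -> cont_at x (fun y => \sum_(i <- r) f i y).
Proof.
move=> cf; elim: r => [|i r IH].
  rewrite (_ : (fun y => _) = fun=> 0); first exact: cst_continuous.
  by apply/funext => y; rewrite big_nil.
rewrite (_ : (fun y => _) = fun y => f i y + \sum_(j <- r) f j y).
  exact: cont_at_add.
by apply/funext => y; rewrite big_cons.
Qed.

End continuity.

Section dot.
Context {R : realType} {n : nat}.
Implicit Types x y b : 'rV[R]_n.
Local Notation pt := (R * 'rV[R]_n)%type.

Lemma cont_at_fst (p : pt) : cont_at p (fun q : pt => q.1).
Proof. exact: for_continuous_fst. Qed.

Lemma cont_at_coord i (p : pt) : cont_at p (fun q : pt => q.2 0 i).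
Proof. exact: (continuous_comp (@for_continuous_snd _ _ p) (@coord_continuous _ _ _ 0 i _)). Qed.

Lemma cont_at_dot b (p : pt) : cont_at p (fun q : pt => dot q.2 b).
Proof.
apply: cont_at_sum => i; apply: cont_at_mul; first exact: cont_at_coord.
exact: cst_continuous.
Qed.

Lemma cont_at_sqdot (p : pt) : cont_at p (fun q : pt => dot q.2 q.2).
Proof. by apply: cont_at_sum => i; apply: cont_at_mul; exact: cont_at_coord. Qed.

Lemma dotC x y : dot x y = dot y x.
Proof. by apply: eq_bigr => i _; rewrite mulrC. Qed.

Lemma dotDl x y z : dot (x + y) z = dot x z + dot y z.
Proof. by rewrite /dot -big_split; apply: eq_bigr => i _; rewrite mxE mulrDl. Qed.

Lemma dotZl c x y : dot (c *: x) y = c * dot x y.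
Proof. by rewrite /dot mulr_sumr; apply: eq_bigr => i _; rewrite mxE mulrA. Qed.

Lemma dotDr x y z : dot z (x + y) = dot z x + dot z y.
Proof. by rewrite dotC dotDl !(dotC _ z). Qed.

Lemma dotZr c x y : dot x (c *: y) = c * dot x y.
Proof. by rewrite dotC dotZl dotC. Qed.

Lemma dotNl x y : dot (- x) y = - dot x y.
Proof. by rewrite -scaleN1r dotZl mulN1r. Qed.

Lemma dotNr x y : dot x (- y) = - dot x y.
Proof. by rewrite dotC dotNl dotC. Qed.

Lemma dot_ge0 x : 0 <= dot x x.
Proof. by apply: sumr_ge0 => i _; rewrite -expr2 sqr_ge0. Qed.

Lemma dot_delta x i : dot x (delta_mx 0 i) = x 0 i.
Proof.
rewrite /dot (bigD1 i) //= big1 => [|j ji]; first by rewrite !mxE !eqxx mulr1 addr0.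
by rewrite !mxE (negbTE ji) andbF mulr0.
Qed.

Lemma dot_line b x i (s : R) : dot (x + s *: delta_mx 0 i) b = dot x b + s * b 0 i.
Proof. by rewrite dotDl dotZl [dot (delta_mx _ _) _]dotC dot_delta. Qed.

Lemma sqdot_line x i (s : R) : let y := x + s *: delta_mx 0 i in
  dot y y = dot x x + 2 * s * x 0 i + s ^+ 2.
Proof.
rewrite /= dot_line dotDr dotZr dot_delta !mxE !eqxx mulr1; ring.
Qed.

Lemma coord_line x i (s : R) : (x + s *: delta_mx 0 i) 0 i = x 0 i + s.
Proof. by rewrite !mxE !eqxx mulr1. Qed.

Lemma sqr_coord_le x i : x 0 i ^+ 2 <= dot x x.
Proof.
rewrite /dot (bigD1 i) //= expr2 lerDl; apply: sumr_ge0 => j _.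
by rewrite -expr2 sqr_ge0.
Qed.

Lemma sqr_norm_le_dot x : `|x| ^+ 2 <= dot x x.
Proof.
rewrite -(sqr_sqrtr (dot_ge0 x)) ler_pXn2r ?nnegrE ?sqrtr_ge0 //.
apply: rV_norm_le => [|i]; first exact: sqrtr_ge0.
by rewrite -sqrtr_sqr ler_wsqrtr // sqr_coord_le.
Qed.

End dot.

Ltac cont_step := lazymatch goal with
  | |- cont_at _ (fun p => @?a p + @?b p) => notypeclasses refine (cont_at_add _ _)
  | |- cont_at _ (fun p => - @?a p) => notypeclasses refine (cont_at_opp _)
  | |- cont_at _ (fun p => @?a p * @?b p) => notypeclasses refine (cont_at_mul _ _)
  | |- cont_at _ (fun p => @?a p ^+ _) => notypeclasses refine (@cont_at_pow _ _ _ _ _ _)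
  | |- cont_at _ (fun p => expR (@?a p)) => notypeclasses refine (cont_at_exp _)
  | |- cont_at _ fst => exact: cont_at_fst
  | |- cont_at _ (fun p => dot p.2 p.2) => exact: cont_at_sqdot
  | |- cont_at _ (fun p => dot p.2 _) => exact: cont_at_dot
  | |- cont_at _ (fun p => fun_of_matrix p.2 _ _) => exact: cont_at_coord
  | |- cont_at _ (fun=> _) => exact: cont_at_cst
  end.
Ltac cont := match goal with |- {for ?x, continuous ?f} => change (cont_at x f) end;
  repeat cont_step.

Section parabolic_closure.
Context {R : realType} {n : nat}.
Local Notation fld := (R -> 'rV[R]_n -> R).

Lemma parabolic_regularD (v vt w wt : fld) (v1 v2 w1 w2 : 'I_n -> fld) :
  parabolic_regular v vt v1 v2 -> parabolic_regular w wt w1 w2 ->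
  parabolic_regular (fun t x => v t x + w t x) (fun t x => vt t x + wt t x)
    (fun i t x => v1 i t x + w1 i t x) (fun i t x => v2 i t x + w2 i t x).
Proof.
move=> [cv dv dv1 dv2] [cw dw dw1 dw2]; split.
- by move=> t x t0; apply: cont_at_add; [exact: cv|exact: cw].
- by move=> t x t0; apply: is_derive_add; [exact: dv|exact: dw].
- by move=> i t x t0; apply: is_derive_add; [exact: dv1|exact: dw1].
- by move=> i t x t0; apply: is_derive_add; [exact: dv2|exact: dw2].
Qed.

Lemma parabolic_regularN (v vt : fld) (v1 v2 : 'I_n -> fld) :
  parabolic_regular v vt v1 v2 ->
  parabolic_regular (fun t x => - v t x) (fun t x => - vt t x)
    (fun i t x => - v1 i t x) (fun i t x => - v2 i t x).
Proof.
move=> [cv dv dv1 dv2]; split.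
- by move=> t x t0; apply: cont_at_opp; exact: cv.
- by move=> t x t0; apply: is_derive_opp; exact: dv.
- by move=> i t x t0; apply: is_derive_opp; exact: dv1.
- by move=> i t x t0; apply: is_derive_opp; exact: dv2.
Qed.

(* A strict supersolution of [v_t = Lap v + k v] that tends to infinity with [x]. *)
Definition growth (c k t : R) (x : 'rV[R]_n) : R :=
  c * (expR (k * t) * (1 + dot x x + (2 * n%:R + 1) * t)).

Lemma parabolic_growth (c k : R) : parabolic_regular (growth c k)
  (fun t x => k * growth c k t x + c * expR (k * t) * (2 * n%:R + 1))
  (fun i t x => 2 * c * expR (k * t) * x 0 i) (fun i t x => 2 * c * expR (k * t)).
Proof.
split.
- by move=> t x _; rewrite /growth; cont.
- by move=> t x _; rewrite /growth; derive; ring.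
- move=> i t x _; rewrite /growth.
  under eq_fun do rewrite sqdot_line; derive; ring.
- move=> i t x _.
  under eq_fun do rewrite coord_line; derive; ring.
Qed.
End parabolic_closure.

(* [lra] reifies the whole context: dropping the hypotheses it cannot use makes it
   several times faster. *)
Ltac lin := repeat match goal with
  | x := _ |- _ => clearbody x
  | H : forall _, _ |- _ => clear H
  | H : parabolic_regular _ _ _ _ |- _ => clear H
  | H : bounded_classical_solution _ _ _ |- _ => clear H
  end; lra.

(** * Comparison with initial data attained in L^1_loc *)

Section weak_comparison.
Context {R : realType} {n : nat}.
Local Notation fld := (R -> 'rV[R]_n -> R).
Local Notation RT := (measurableTypeR R).

Lemma growth_ge (c k t : R) (x : 'rV[R]_n) : 0 < c -> 0 <= k -> 0 <= t ->
  c * (1 + dot x x) <= growth c k t x.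
Proof.
move=> c0 k0 t0; rewrite /growth ler_pM2l //.
have e1 : 1 <= expR (k * t) by have := expR_ge1Dx (k * t); have := mulr_ge0 k0 t0; lin.
have q0 : 0 <= (2 * n%:R + 1) * t by rewrite mulr_ge0 // addr_ge0 // mulr_ge0.
have d0 := dot_ge0 x.
rewrite -[leLHS]mul1r; apply: ler_pM => //; lin.
Qed.

Lemma cube_averageZ (h k : R) (g : 'rV[R]_n -> R) : 0 < h -> continuous g ->
  cube_average h (fun v => k * g v) = k * cube_average h g.
Proof.
move=> h0 cg; rewrite /cube_average RintegralZl; first by rewrite mulrCA.
- exact: measurable_tuple_cube.
- by apply: integrable_cube => //; exact: ltW.
Qed.

(* The maximum principle is applied to the cube averages of [v], for which the initial
   values are attained locally uniformly, from a small positive time on. *)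
Lemma weak_comparison (k m M h1 : R) (v vt p pt : fld) (v1 v2 p1 p2 : 'I_n -> fld)
    (v0 : 'rV[R]_n -> R) :
  0 <= k ->
  parabolic_regular v vt v1 v2 -> pos_continuous vt ->
  (forall i, pos_continuous (v1 i)) -> (forall i, pos_continuous (v2 i)) ->
  (forall t x, 0 < t -> \sum_i v2 i t x + k * v t x <= vt t x) ->
  (forall t x, 0 < t -> m <= v t x) ->
  measurable_fun [set: n.-tuple RT] (v0 \o row_of_tuple) ->
  (forall K : set 'rV[R]_n, compact K -> L1_dist K (v t) v0 @[t --> 0^'+] --> 0%E) ->
  parabolic_regular p pt p1 p2 ->
  (forall t x, 0 < t -> m < p t x -> pt t x <= \sum_i p2 i t x + k * p t x) ->
  (forall t x, 0 < t -> p t x <= M) ->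
  0 < h1 ->
  (forall h, 0 < h <= h1 -> exists2 d, 0 < d & forall t x y, 0 < t < d ->
     row_cube h y -> p t x <= v0 (x + y)) ->
  forall t x, 0 < t -> p t x <= v t x.
Proof.
move=> k0 rv cvt cv1 cv2 ev vm mv0 L1 rp ep pM h10 p0 t1 x1 t10.
have cv := pr_cont rv.
apply/ler_addgt0Pr => e e0.
pose G := growth 1 k t1 x1.
have G1 : 1 <= G.
  have := @growth_ge 1 k t1 x1 ltr01 k0 (ltW t10); rewrite mul1r; have := dot_ge0 x1; rewrite -/G; lin.
(* With this choice the growth term equals e / 2 at (t1, x1); the other e / 2 pays for replacing v
   by its average there. *)
pose c := e / (2 * G).
have c0 : 0 < c by rewrite divr_gt0 // mulr_gt0 //; lin.
have e20 : 0 < e / 2 by rewrite divr_gt0.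
have [h0 h00 avg_near] := cvg_space_average x1 cv t10 e20.
pose h := Num.min h0 h1.
have hp : 0 < h by rewrite lt_min h00.
have hh0 : h <= h0 by rewrite ge_min lexx.
have hh1 : h <= h1 by rewrite ge_min lexx orbT.
pose a := space_average h v.
have ra := parabolic_regular_average hp rv cvt cv1 cv2.
have ea t x : 0 < t ->
    \sum_i space_average h (v2 i) t x + k * a t x <= space_average h vt t x.
  move=> t0; have cs : continuous (fun y => \sum_i v2 i t (x + y)).
    by move=> y; apply: (@cont_at_sum _ _ _ _ (fun i y => v2 i t (x + y))) => i; exact: pos_continuous_row.
  have ck : continuous (fun y => k * v t (x + y)).
    by move=> y; apply: cont_at_mul; [exact: cst_continuous|exact: pos_continuous_row].
  rewrite /a /space_average -cube_average_sum //; last by move=> i; exact: pos_continuous_row.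
  rewrite -cube_averageZ //; last exact: pos_continuous_row.
  rewrite -cube_averageD //; apply: le_cube_average => //.
  - by move=> y; exact: (cont_at_add (cs y) (ck y)).
  - exact: pos_continuous_row.
  - by move=> y _; exact: ev.
have am t x : 0 < t -> m <= a t x.
  move=> t0; rewrite -[m](@cube_average_cst _ n h m hp); apply: le_cube_average => //.
  - exact: cst_continuous.
  - exact: pos_continuous_row.
  - by move=> y _; exact: vm.
(* For |x| > r the growth term exceeds M - m, hence also p minus the average. *)
pose r := 1 + `|M - m| / c.
have q0 : 0 <= `|M - m| / c by rewrite divr_ge0 // ltW.
have r1 : 1 <= r by rewrite /r; lin.
have cr : M - m <= c * r ^+ 2.
  apply: (@le_trans _ _ (c * r)).
    rewrite /r mulrDr mulr1 [c * _]mulrC divfK ?gt_eqF //.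
    have := ler_norm (M - m); lin.
  by rewrite ler_pM2l // expr2 ler_peMr //; lin.
have c20 : 0 < c / 2 by rewrite divr_gt0.
(* The growth term is at least c at time T0, so an initial error c / 2 still leaves strict
   positivity. *)
have [d1 d10 init1] := space_average_initial r cv mv0 L1 hp c20.
have [d2 d20 init2] := p0 h (ltac:(by rewrite hp hh1)).
pose T0 := Num.min (Num.min d1 d2) t1 / 2.
have m0 : 0 < Num.min (Num.min d1 d2) t1 by rewrite !lt_min d10 d20 t10.
have T00 : 0 < T0 by rewrite divr_gt0.
have [T0d1 T0d2 T0t1] : [/\ T0 < d1, T0 < d2 & T0 < t1].
  have H : T0 < Num.min (Num.min d1 d2) t1 by rewrite /T0; lin.
  by split; apply: lt_le_trans H _; rewrite !ge_min lexx ?orbT.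
have rw := parabolic_regularD (parabolic_regularD ra (parabolic_regularN rp)) (parabolic_growth c k).
have far t x : 0 < t -> r < `|x| -> 0 < a t x - p t x + growth c k t x.
  move=> t0 rx; have := growth_ge x c0 k0 (ltW t0).
  have H : r ^+ 2 <= dot x x.
    apply: le_trans (sqr_norm_le_dot x); rewrite ler_pXn2r ?nnegrE ?normr_ge0 ?(ltW rx) //; lin.
  have := am t x t0; have := pM t x t0.
  have : c * r ^+ 2 <= c * dot x x by rewrite ler_pM2l.
  rewrite mulrDr mulr1; lin.
have wpos : 0 < a t1 x1 - p t1 x1 + growth c k t1 x1.
  apply: (comparison_gt0 T00 rw (T1 := t1) (r := r)); last by rewrite lexx (ltW T0t1).
  - move=> x; case: (leP `|x| r) => [xr|]; last exact: far.
    have := growth_ge x c0 k0 (ltW T00); have := dot_ge0 x.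
    have : p T0 x - c / 2 <= a T0 x.
      by apply: init1 => //; [rewrite T00|move=> y hy; apply: init2 => //; rewrite T00].
    have : 0 <= c * dot x x by rewrite mulr_ge0 ?dot_ge0 // ltW.
    rewrite -/a mulrDr mulr1; lin.
  - by move=> t x /andP[T0t _]; apply: far; exact: lt_le_trans T0t.
  - move=> t x /andP[T0t _] w0 wt0 w20; have t0 : 0 < t by exact: lt_trans T0t.
    have g0 : 0 < growth c k t x.
      by apply: lt_le_trans (growth_ge x c0 k0 (ltW t0)); rewrite mulr_gt0 // ltr_wpDr ?dot_ge0.
    (* At the contact p exceeds m, so the inequality for p is available there. The growth term is a
       strict supersolution with surplus c e^(k t), which yields the contradiction. *)
    have ptx : p t x = a t x + growth c k t x by move: w0; rewrite -/a; lin.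
    have := ep t x t0; rewrite ptx => /(_ _)/wrap[]; first by have := am t x t0; lin.
    have := ea t x t0.
    have : 0 <= \sum_i (space_average h (v2 i) t x - p2 i t x + 2 * c * expR (k * t)).
      by apply: sumr_ge0 => i _; exact: w20.
    rewrite !big_split /= sumrN sumr_const card_ord -mulr_natr.
    have : 0 < c * expR (k * t) by rewrite mulr_gt0 // expR_gt0.
    move: wt0; set A := space_average _ vt _ _; set B := \sum_i _; set C := \sum_i _.
    set D := growth _ _ _ _; set E := expR _.
    by rewrite mulrDr; lin.
have := avg_near h (ltac:(by rewrite hp hh0)); rewrite ler_norml => /andP[_].
move: wpos; rewrite /growth -/(growth 1 k t1 x1).
have -> : c * (expR (k * t1) * (1 + dot x1 x1 + (2 * n%:R + 1) * t1)) = e / 2.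
  by rewrite -[X in c * X]mul1r -/(growth 1 k t1 x1) -/G /c; field; lin.
rewrite -/a; lin.
Qed.

End weak_comparison.

Section solution_comparison.
Context {R : realType} {n : nat}.
Local Notation fld := (R -> 'rV[R]_n -> R).
Local Notation RT := (measurableTypeR R).

(** The extension by 0 makes this true for every real s, so it can be used before the sign of u is
    known. *)
Lemma logistic_ge0 (s : R) : 0 <= logistic s.
Proof. by rewrite /logistic; case: ifPn => // /andP[s0 s1]; rewrite mulr_ge0 // subr_ge0. Qed.

Lemma logistic_le (s : R) : 0 <= s -> logistic s <= s.
Proof.
move=> s0; rewrite /logistic; case: ifPn => // /andP[_ s1].
by rewrite -[leRHS]mulr1 ler_wpM2l // gerBl.
Qed.

Lemma parabolic_regular_cst (c : R) : parabolic_regular (fun _ (_ : 'rV[R]_n) => c)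
  (fun _ _ => 0) (fun _ _ _ => 0) (fun _ _ _ => 0).
Proof.
split; [by move=> t x _; exact: (@cont_at_cst _ _ (t, x) c)|..].
- by move=> t x _; exact: is_derive_cst1.
- by move=> i t x _; exact: is_derive_cst1.
- by move=> i t x _; exact: is_derive_cst1.
Qed.

Context {u : fld} {u0 : 'rV[R]_n -> R}.
Hypothesis hu : bounded_classical_solution logistic u0 u.
Hypothesis mu0 : measurable_fun [set: n.-tuple RT] (u0 \o row_of_tuple).
Hypothesis u0_ge0 : forall x, 0 <= u0 x.

Let cu : pos_continuous u. Proof. by case: hu => -[]. Qed.
Let ru := class_C12_parabolic (let: And4 h _ _ _ := hu in h).
Let cdt : pos_continuous (dt u). Proof. by case: hu => -[_ []]. Qed.
Let cd1 i : pos_continuous (dx i u). Proof. by case: hu => -[_ _ H _] _ _ _; exact: (H i).2. Qed.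
Let cd2 i : pos_continuous (dx i (dx i u)).
Proof. by case: hu => -[_ _ _ H] _ _ _; exact: (H i i).2. Qed.
Let eu t x : 0 < t -> dt u t x = \sum_i dx i (dx i u) t x + logistic (u t x).
Proof. by case: hu => _ _ H _; exact: H. Qed.

Lemma solution_ge0 t x : 0 < t -> 0 <= u t x.
Proof.
case: hu => _ [M HM] _ L1 t0.
apply: (@weak_comparison _ n 0 (- M) 0 1 u (dt u) (fun _ _ => 0) (fun _ _ => 0)
  (fun i => dx i u) (fun i => dx i (dx i u)) (fun _ _ _ => 0) (fun _ _ _ => 0) u0) => //.
- by move=> s y s0; rewrite mul0r addr0 eu // lerDl logistic_ge0.
- by move=> s y s0; have := HM s y s0; rewrite ler_norml => /andP[].
- exact: parabolic_regular_cst.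
- by move=> s y _ _; rewrite big1 // mulr0 addr0.
- by move=> h _; exists 1.
Qed.

(** Since u >= 0, [weak_comparison] applies with m = 0: the barrier has to be a subsolution of the
    heat equation only where it is positive, as the bumps are. *)
Lemma solution_ge_subsolution (p pt : fld) (p1 p2 : 'I_n -> fld) (M h1 : R) :
  parabolic_regular p pt p1 p2 ->
  (forall t x, 0 < t -> 0 < p t x -> pt t x <= \sum_i p2 i t x) ->
  (forall t x, 0 < t -> p t x <= M) -> 0 < h1 ->
  (forall h, 0 < h <= h1 -> exists2 d, 0 < d & forall t x y, 0 < t < d ->
     row_cube h y -> p t x <= u0 (x + y)) ->
  forall t x, 0 < t -> p t x <= u t x.
Proof.
move=> rp ep pM h10 p0.
case: hu => _ _ _ L1.
apply: (@weak_comparison _ n 0 0 M h1 u (dt u) p pt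
  (fun i => dx i u) (fun i => dx i (dx i u)) p1 p2 u0) => //.
- by move=> s y s0; rewrite mul0r addr0 eu // lerDl logistic_ge0.
- by move=> s y s0; exact: solution_ge0.
- by move=> s y s0 py; rewrite mul0r addr0; exact: ep.
Qed.

(** Comparison from below for - u, which satisfies v_t >= Lap v + v because logistic u <= u when u
    >= 0; hence the rate 1. *)
Lemma solution_le_supersolution (p pt : fld) (p1 p2 : 'I_n -> fld) (h1 : R) :
  parabolic_regular p pt p1 p2 ->
  (forall t x, 0 < t -> \sum_i p2 i t x + p t x <= pt t x) ->
  (forall t x, 0 < t -> 0 <= p t x) -> 0 < h1 ->
  (forall h, 0 < h <= h1 -> exists2 d, 0 < d & forall t x y, 0 < t < d ->
     row_cube h y -> u0 (x + y) <= p t x) ->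
  forall t x, 0 < t -> u t x <= p t x.
Proof.
move=> rp ep pM h10 p0 t x t0; rewrite -lerN2.
case: hu => _ [M HM] _ L1.
have Ncont (w : fld) : pos_continuous w -> pos_continuous (fun t x => - w t x).
  by move=> cw s y s0; apply: cont_at_opp; exact: cw.
apply: (@weak_comparison _ n 1 (- M) 0 h1 (fun t x => - u t x) (fun t x => - dt u t x)
  (fun t x => - p t x) (fun t x => - pt t x)
  (fun i t x => - dx i u t x) (fun i t x => - dx i (dx i u) t x)
  (fun i t x => - p1 i t x) (fun i t x => - p2 i t x) (fun x => - u0 x)) => //.
- exact: parabolic_regularN.
- exact: (Ncont _ cdt).
- by move=> i; exact: (Ncont _ (@cd1 i)).
- by move=> i; exact: (Ncont _ (@cd2 i)).
- by move=> s y s0; rewrite sumrN mul1r -opprD lerN2 eu // lerD2l logistic_le // solution_ge0.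
- by move=> s y s0; have := HM s y s0; rewrite ler_norml lerN2 => /andP[].
- exact: measurableT_comp.
- move=> K cK; rewrite (_ : (fun s => _) = fun s => L1_dist K (u s) u0); first exact: L1.
  apply/funext => s; apply: eq_integral => v _.
  by rewrite -opprD normrN.
- exact: parabolic_regularN.
- by move=> s y s0 _; rewrite sumrN mul1r -opprD lerN2 ep.
- by move=> s y s0; rewrite oppr_le0 pM.
- by move=> h hh; have [d d0 H] := p0 h hh; exists d => // s y v sd hv; rewrite lerN2 H.
Qed.

End solution_comparison.

(** * Spreading from below *)

Section euclidean_norm.
Context {R : realType} {n : nat}.
Implicit Types x y b : 'rV[R]_n.

Lemma enorm_ge0 x : 0 <= enorm x.
Proof. exact: sqrtr_ge0. Qed.

Lemma sqr_enorm x : enorm x ^+ 2 = dot x x.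
Proof. by rewrite sqr_sqrtr ?dot_ge0. Qed.

Lemma norm_le_enorm x : `|x| <= enorm x.
Proof.
by rewrite -(@ler_pXn2r _ 2%N) ?nnegrE ?enorm_ge0 // sqr_enorm sqr_norm_le_dot.
Qed.

Lemma enorm_le x (r : R) : 0 <= r -> (enorm x <= r) = (dot x x <= r ^+ 2).
Proof. by move=> r0; rewrite -sqr_enorm ler_pXn2r ?nnegrE ?enorm_ge0. Qed.

Lemma enormZ (c : R) x : enorm (c *: x) = `|c| * enorm x.
Proof. by rewrite /enorm dotZl dotZr mulrA -expr2 sqrtrM ?sqr_ge0 // sqrtr_sqr. Qed.

Lemma enormN x : enorm (- x) = enorm x.
Proof. by rewrite -scaleN1r enormZ normrN normr1 mul1r. Qed.

Lemma enorm0 : enorm (0 : 'rV[R]_n) = 0.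
Proof. by rewrite -[X in enorm X](scale0r 0) enormZ normr0 mul0r. Qed.

Lemma dot_cauchy_schwarz x y : dot x y ^+ 2 <= dot x x * dot y y.
Proof.
have [y0|yn0] := eqVneq (dot y y) 0.
  have y00 i : y 0 i = 0.
    by have := sqr_coord_le y i; rewrite y0 => H; apply/eqP; rewrite -sqrf_eq0 eq_le H sqr_ge0.
  by rewrite {1}/dot big1 ?expr0n /= ?y0 ?mulr0 // => i _; rewrite y00 mulr0.
have yp : 0 < dot y y by rewrite lt_neqAle eq_sym yn0 dot_ge0.
have := dot_ge0 (dot y y *: x - dot x y *: y).
rewrite dotDl !dotDr !dotNl !dotNr !dotZl !dotZr [dot y x]dotC.
rewrite (_ : _ + _ = dot y y * (dot x x * dot y y - dot x y ^+ 2)); last ring.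
by rewrite pmulr_rge0 // subr_ge0.
Qed.

Lemma dot_le_enorm x y : dot x y <= enorm x * enorm y.
Proof.
have := dot_cauchy_schwarz x y; rewrite -!sqr_enorm -exprMn => H.
rewrite real_leNgt ?num_real //; apply/negP => lt.
have p0 : 0 <= enorm x * enorm y by rewrite mulr_ge0 ?enorm_ge0.
by move: H; rewrite leNgt ltr_pXn2r ?nnegrE ?lt // ltW // (le_lt_trans p0).
Qed.

Lemma enormD_le x y : enorm (x + y) <= enorm x + enorm y.
Proof.
rewrite enorm_le ?addr_ge0 ?enorm_ge0 // dotDl !dotDr [dot y x]dotC -!sqr_enorm.
have := dot_le_enorm x y; nra.
Qed.

Lemma enormB_ge x y : enorm x - enorm y <= enorm (x - y).
Proof. by rewrite lerBlDr -{1}(subrK y x) enormD_le. Qed.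

End euclidean_norm.

Section bump.
Context {R : realType} {n : nat}.
Local Notation fld := (R -> 'rV[R]_n -> R).

(* [A e^(- K t - y.b / 2) (L^2 - |y|^2)^3] with [y = x - t b].  The odd power makes the
   function smooth and nonpositive outside the moving ball [|y| < L]. *)
Definition bump (A K L : R) (b : 'rV[R]_n) : fld := fun t x =>
  A * expR (- (K * t) - (dot x b - t * dot b b) / 2) *
  (L ^+ 2 - (dot x x - 2 * t * dot x b + t ^+ 2 * dot b b)) ^+ 3.

Lemma bump_center (t : R) (x b : 'rV[R]_n) :
  dot x x - 2 * t * dot x b + t ^+ 2 * dot b b = dot (x - t *: b) (x - t *: b).
Proof. rewrite dotDl !dotDr !dotNl !dotNr !dotZl !dotZr [dot b x]dotC; ring. Qed.

Lemma bump_regular (A K L : R) (b : 'rV[R]_n) :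
  let E t x := A * expR (- (K * t) - (dot x b - t * dot b b) / 2) in
  let q t x := L ^+ 2 - (dot x x - 2 * t * dot x b + t ^+ 2 * dot b b) in
  let d i (t : R) (x : 'rV[R]_n) := - (2 * x 0 i) + 2 * t * b 0 i in
  parabolic_regular (bump A K L b)
    (fun t x => E t x * ((- K + dot b b / 2) * q t x ^+ 3
                + 3 * q t x ^+ 2 * (2 * dot x b - 2 * t * dot b b)))
    (fun i t x => E t x * (- (b 0 i / 2) * q t x ^+ 3 + 3 * q t x ^+ 2 * d i t x))
    (fun i t x => E t x * (b 0 i ^+ 2 / 4 * q t x ^+ 3 - 3 * b 0 i * q t x ^+ 2 * d i t x
                + 6 * q t x * d i t x ^+ 2 - 6 * q t x ^+ 2)).
Proof.
move=> E q d; split.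
- by move=> t x _; rewrite /bump; cont.
- move=> t x _; rewrite /bump /E /q; derive; by field.
- move=> i t x _; rewrite /bump /E /q /d.
  under eq_fun do rewrite sqdot_line dot_line; derive.
  by rewrite !mul0r !addr0 !mulr0 !addr0 expr0n /= !addr0; field.
- move=> i t x _; rewrite /E /q /d.
  under eq_fun do rewrite sqdot_line dot_line coord_line; derive.
  by rewrite !mul0r !addr0 !mulr0 !addr0 expr0n /= !addr0; field.
Qed.
End bump.

Section bump_bounds.
Context {R : realType} {n : nat}.
Implicit Types x b : 'rV[R]_n.

(** The exponential weight makes the terms in y.b cancel, with y = x - t b. After division by E q
    there remains (24 + 6 n) q <= ka q^2 + 24 L^2, the inequality of arithmetic and geometric means
    under the hypothesis on ka. *)
Lemma bump_subsolution (A K L ka t : R) b x :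
  let E := A * expR (- (K * t) - (dot x b - t * dot b b) / 2) in
  let q := L ^+ 2 - (dot x x - 2 * t * dot x b + t ^+ 2 * dot b b) in
  let d i := - (2 * x 0 i) + 2 * t * b 0 i in
  0 < A -> 0 < q -> (24 + 6 * n%:R) ^+ 2 <= 96 * ka * L ^+ 2 ->
  E * ((- K + dot b b / 2) * q ^+ 3 + 3 * q ^+ 2 * (2 * dot x b - 2 * t * dot b b)) <=
  \sum_i E * (b 0 i ^+ 2 / 4 * q ^+ 3 - 3 * b 0 i * q ^+ 2 * d i
                + 6 * q * d i ^+ 2 - 6 * q ^+ 2)
  + (dot b b / 4 - K + ka) * bump A K L b t x.
Proof.
move=> E q d A0 q0 hka.
have E0 : 0 < E by rewrite mulr_gt0 // expR_gt0.
have -> : bump A K L b t x = E * q ^+ 3 by [].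
have Sbb : \sum_i b 0 i * b 0 i = dot b b by [].
have Sbd : \sum_i b 0 i * d i = - 2 * dot x b + 2 * t * dot b b.
  rewrite /dot !mulr_sumr -big_split; apply: eq_bigr => i _; rewrite /d /=; ring.
have Sdd : \sum_i d i * d i = 4 * (dot x x - 2 * t * dot x b + t ^+ 2 * dot b b).
  rewrite /dot !mulr_sumr -sumrN -!big_split mulr_sumr; apply: eq_bigr => i _; rewrite /d /=; ring.
have -> : \sum_i E * (b 0 i ^+ 2 / 4 * q ^+ 3 - 3 * b 0 i * q ^+ 2 * d i
                + 6 * q * d i ^+ 2 - 6 * q ^+ 2) =
   E * (q ^+ 3 / 4 * dot b b - 3 * q ^+ 2 * (- 2 * dot x b + 2 * t * dot b b)
      + 6 * q * (4 * (L ^+ 2 - q)) - 6 * q ^+ 2 * n%:R).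
  have -> : L ^+ 2 - q = dot x x - 2 * t * dot x b + t ^+ 2 * dot b b by rewrite /q opprB addrC subrK.
  rewrite -Sdd -Sbd -{1}Sbb -mulr_sumr; congr (_ * _).
  have -> : 6 * q ^+ 2 * n%:R = \sum_(i < n) 6 * q ^+ 2 by rewrite sumr_const card_ord mulr_natr.
  rewrite !mulr_sumr -!sumrN -!big_split; apply: eq_bigr => i _ /=; by field.
have key : (24 + 6 * n%:R) * q <= ka * q ^+ 2 + 24 * L ^+ 2.
  set N := 24 + 6 * n%:R in hka *.
  have ka0 : 0 <= ka * L ^+ 2 by have := sqr_ge0 N; lra.
  have L2 : 0 < L ^+ 2.
    have := dot_ge0 (x - t *: b); rewrite -bump_center => H; rewrite /q in q0; lra.
  have ka1 : 0 <= ka by rewrite -(pmulr_lge0 _ L2).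
  have : (N * q) ^+ 2 <= (ka * q ^+ 2 + 24 * L ^+ 2) ^+ 2.
    have := sqr_ge0 (ka * q ^+ 2 - 24 * L ^+ 2).
    have : N ^+ 2 * q ^+ 2 <= 96 * ka * L ^+ 2 * q ^+ 2 by rewrite ler_wpM2r // sqr_ge0.
    rewrite (_ : (ka * q ^+ 2 + 24 * L ^+ 2) ^+ 2 =
      (ka * q ^+ 2 - 24 * L ^+ 2) ^+ 2 + 96 * ka * L ^+ 2 * q ^+ 2); last ring.
    by rewrite exprMn; lra.
  have s0 : 0 <= ka * q ^+ 2 + 24 * L ^+ 2 by rewrite addr_ge0 // mulr_ge0 // sqr_ge0.
  have N0 : 0 <= N * q by rewrite mulr_ge0 ?(ltW q0) // addr_ge0 // mulr_ge0.
  by rewrite ler_pXn2r.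
have H : 0 <= E * q * (ka * q ^+ 2 + 24 * L ^+ 2) - E * q * ((24 + 6 * n%:R) * q).
  by rewrite subr_ge0 ler_pM2l // mulr_gt0.
rewrite -subr_ge0; apply: le_trans H _.
rewrite le_eqVlt; apply/orP; left; apply/eqP; by field.
Qed.

Lemma bump_le (A K L t : R) b x : 0 < A -> 0 <= K -> 0 <= t -> 0 <= L ->
  bump A K L b t x <= A * expR ((L ^+ 2 + dot b b) / 4) * L ^+ 6.
Proof.
move=> A0 K0 t0 L0; rewrite /bump.
set q := L ^+ 2 - _; set E := expR _.
have M0 : 0 <= A * expR ((L ^+ 2 + dot b b) / 4) * L ^+ 6.
  by rewrite mulr_ge0 ?exprn_ge0 // mulr_ge0 ?expR_ge0 // ltW.
have [q0|qp] := lerP q 0.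
  apply: le_trans M0; apply: mulr_ge0_le0; first by rewrite mulr_ge0 ?expR_ge0 // ltW.
  by rewrite exprS mulr_le0_ge0 // sqr_ge0.
have yy := dot_ge0 (x - t *: b).
(* From |y + b|^2 >= 0 one gets - y.b / 2 <= (|y|^2 + |b|^2) / 4, whence the exponent in the
   bound. *)
have yb := dot_ge0 ((x - t *: b) + b).
have qE : q = L ^+ 2 - dot (x - t *: b) (x - t *: b) by rewrite /q bump_center.
apply: ler_pM.
- by rewrite mulr_ge0 ?expR_ge0 // ltW.
- by rewrite exprn_ge0 // ltW.
- rewrite ler_pM2l // ler_expR.
  have Kt : 0 <= K * t by rewrite mulr_ge0.
  move: yb; rewrite !dotDl !dotDr !dotNl !dotNr !dotZl !dotZr [dot b x]dotC.
  rewrite !dotDl !dotDr !dotNl !dotNr !dotZl !dotZr [dot b x]dotC in yy qE.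
  move: qp; rewrite qE => qp yb; lra.
- have -> : L ^+ 6 = (L ^+ 2) ^+ 3 by rewrite -exprM.
  rewrite ler_pXn2r ?nnegrE ?(ltW qp) ?sqr_ge0 //.
  by rewrite qE; lra.
Qed.

Lemma bump_gt0 (A K L t : R) b x : 0 < A -> 0 < bump A K L b t x ->
  enorm (x - t *: b) < `|L|.
Proof.
move=> A0; rewrite /bump bump_center => H.
have q0 : 0 < L ^+ 2 - dot (x - t *: b) (x - t *: b).
  rewrite ltNge; apply/negP => q0; move: H; rewrite ltNge => /negP; apply.
  apply: mulr_ge0_le0; first by rewrite mulr_ge0 ?expR_ge0 // ltW.
  by rewrite exprS mulr_le0_ge0 // sqr_ge0.
rewrite -(@ltr_pXn2r _ 2%N) ?nnegrE ?enorm_ge0 // sqr_enorm real_normK ?num_real //.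
by rewrite -subr_gt0.
Qed.

Lemma bump_at_center (A K L t : R) b : bump A K L b t (t *: b) = A * expR (- (K * t)) * L ^+ 6.
Proof.
rewrite /bump bump_center subrr dotZl subrr mul0r subr0 /dot big1 => [|i _].
  by rewrite subr0 -exprM.
by rewrite mxE mul0r.
Qed.

End bump_bounds.

Section solution_lower.
Context {R : realType} {n : nat}.
Local Notation fld := (R -> 'rV[R]_n -> R).
Local Notation RT := (measurableTypeR R).
Context {u : fld} {u0 : 'rV[R]_n -> R}.
Hypothesis hu : bounded_classical_solution logistic u0 u.
Hypothesis mu0 : measurable_fun [set: n.-tuple RT] (u0 \o row_of_tuple).
Hypothesis u0_ge0 : forall x, 0 <= u0 x.
Hypothesis u0_near0 : exists2 r0 : R, 0 < r0 & forall x, `|x| <= r0 -> 1 <= u0 x.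

Let ru : parabolic_regular u (dt u) (fun i => dx i u) (fun i => dx i (dx i u)).
Proof. by apply: class_C12_parabolic; case: hu. Qed.
Let eu t x : 0 < t -> dt u t x = \sum_i dx i (dx i u) t x + logistic (u t x).
Proof. by case: hu => _ _ H _; exact: H. Qed.

(** The left-hand side is the value at its centre of a bump with velocity b = x / t. The decay rate
    K = |b|^2 / 4 + ka makes it a subsolution of the heat equation, and A keeps it below 1. *)
Lemma solution_ge_gauss : exists L ka : R, [/\ 0 < L, 0 <= ka & forall t x, 0 < t ->
  expR (- ((L ^+ 2 + dot x x / t ^+ 2) / 4) - (dot x x / t ^+ 2 / 4 + ka) * t) * L ^+ 6 <= u t x].
Proof.
have [r0 r00 near0] := u0_near0.
pose L := Num.min (r0 / 4) 1.
have L0 : 0 < L by rewrite lt_min ltr01 andbT divr_gt0.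
have L1 : L <= 1 by rewrite ge_min lexx orbT.
have Lr : L <= r0 / 4 by rewrite ge_min lexx.
pose ka : R := (24 + 6 * n%:R) ^+ 2 / (96 * L ^+ 2).
have L20 : 0 < L ^+ 2 by rewrite exprn_gt0.
have ka0 : 0 <= ka by rewrite divr_ge0 ?sqr_ge0 // mulr_ge0 // ltW.
have hka : (24 + 6 * n%:R) ^+ 2 <= 96 * ka * L ^+ 2.
  by rewrite -mulrA [ka * _]mulrC mulrA [X in _ <= X]mulrC /ka divfK // mulf_neq0 // gt_eqF.
exists L, ka; split => // t x t0.
pose b := t^-1 *: x.
have xb : x = t *: b by rewrite scalerA divff ?scale1r // gt_eqF.
have bb : dot b b = dot x x / t ^+ 2 by rewrite dotZl dotZr; field; rewrite gt_eqF.
pose K := dot b b / 4 + ka.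
have K0 : 0 <= K by rewrite addr_ge0 // divr_ge0 // dot_ge0.
pose A := expR (- ((L ^+ 2 + dot b b) / 4)).
have A0 : 0 < A by exact: expR_gt0.
have bump1 s y : 0 < s -> bump A K L b s y <= 1.
  move=> s0; apply: le_trans (bump_le _ _ A0 K0 (ltW s0) (ltW L0)) _.
  rewrite /A -expRD addNr expR0 mul1r; apply: exprn_ile1 => //; exact: ltW.
have -> : expR (- ((L ^+ 2 + dot x x / t ^+ 2) / 4) - (dot x x / t ^+ 2 / 4 + ka) * t) * L ^+ 6
    = bump A K L b t x.
  by rewrite [in RHS]xb bump_at_center /A -expRD -bb.
apply: (@solution_ge_subsolution _ _ u u0 hu mu0 u0_ge0 _ _ _ _ 1 (r0 / 4) (bump_regular A K L b)) => //.
- move=> s y s0 bpos.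
  have q0 := bump_gt0 A0 bpos.
  have {}q0 : 0 < L ^+ 2 - (dot y y - 2 * s * dot y b + s ^+ 2 * dot b b).
    rewrite bump_center subr_gt0 -sqr_enorm ltr_pXn2r ?nnegrE ?enorm_ge0 ?(ltW L0) //.
    by rewrite -(gtr0_norm L0).
  have := bump_subsolution K A0 q0 hka.
  by rewrite (_ : dot b b / 4 - K + ka = 0) ?mul0r ?addr0 // /K; ring.
- by rewrite divr_gt0.
(* Within this time the centre moves by less than L, so the positive part of the bump lies in |z| <=
   2 L <= r0 / 2; adding a cube of side at most r0 / 4 stays within r0. *)
- move=> h /andP[h0 hr]; exists (L / (1 + enorm b)).
    by rewrite divr_gt0 // ltr_pwDl // enorm_ge0.
  move=> s z y /andP[s0]; rewrite ltr_pdivlMr; last by rewrite ltr_pwDl // enorm_ge0.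
  move=> sL hy; have [bn|bp] := lerP (bump A K L b s z) 0; first exact: le_trans bn _.
  apply: le_trans (bump1 s z s0) _; apply: near0.
  have := bump_gt0 A0 bp; rewrite (gtr0_norm L0) => zL.
  have zz : `|z| <= 2 * L.
    apply: le_trans (norm_le_enorm _) _; rewrite -[z](subrK (s *: b)).
    apply: le_trans (enormD_le _ _) _; rewrite enormZ (gtr0_norm s0).
    by have := enorm_ge0 b; lin.
  have yy : `|y| <= r0 / 4.
    apply: rV_norm_le => [|i]; first by rewrite divr_ge0 // ltW.
    have := hy i; rewrite /= in_itv /= => /andP[y0 yh].
    by rewrite ger0_norm //; exact: le_trans hr.
  apply: le_trans (ler_normD _ _) _; lin.
Qed.

Lemma solution_gt0 t x : 0 < t -> 0 < u t x.
Proof.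
move=> t0; have [L [ka [L0 _ H]]] := solution_ge_gauss.
by apply: lt_le_trans (H t x t0); rewrite mulr_gt0 ?expR_gt0 // exprn_gt0.
Qed.

Lemma solution_bounded_below (r : R) : exists2 c : R, 0 < c &
  forall x, dot x x <= r -> c <= u 1 x.
Proof.
have [L [ka [L0 ka0 H]]] := solution_ge_gauss.
exists (expR (- ((L ^+ 2 + r) / 4) - (r / 4 + ka)) * L ^+ 6).
  by rewrite mulr_gt0 ?expR_gt0 // exprn_gt0.
move=> x xr; apply: le_trans (H 1 x ltr01).
rewrite ler_pM2r ?exprn_gt0 // ler_expR expr1n divr1 mulr1; lin.
Qed.

(** Bumps without decay (K = 0) and with |b| <= c1 are compared with u from time 1 on. They solve
    v_t <= Lap v + (|b|^2 / 4 + ka) v where positive, and at a contact this rate is less than 1 -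
    u. *)
Lemma solution_spreads (c1 : R) : 0 <= c1 < 2 -> exists2 e : R, 0 < e <= 1 / 2 &
  forall t x, 1 <= t -> enorm x <= c1 * t -> e <= u t x.
Proof.
move=> /andP[c10 c12].
(* The gap 1 - c1^2 / 4 is split in three: the error of the bump, its height m, and a strict
   margin. *)
pose ka := (1 - c1 ^+ 2 / 4) / 3.
have c1s : c1 ^+ 2 < 4 by nra.
have c1s0 := sqr_ge0 c1.
have ka0 : 0 < ka by rewrite /ka; lin.
have ka1 : ka <= 1 / 3 by rewrite /ka; lin.
have kaE : 3 * ka = 1 - c1 ^+ 2 / 4 by rewrite /ka; lin.
pose N : R := 24 + 6 * n%:R.
have N0 : 0 < N by rewrite ltr_wpDr // mulr_ge0.
pose L := N / ka.
have L0 : 0 < L by rewrite divr_gt0.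
have hka : N ^+ 2 <= 96 * ka * L ^+ 2.
  have -> : N = ka * L by rewrite mulrC divfK // gt_eqF.
  rewrite exprMn; apply: ler_wpM2r; first exact: sqr_ge0.
  nra.
(* As |b| <= 2, the bump at time 1 is positive only in |y| < L + 2. *)
have [c c0 clow] := solution_bounded_below ((L + 2) ^+ 2).
pose G := expR ((L ^+ 2 + 4) / 4) * L ^+ 6.
have G0 : 0 < G by rewrite mulr_gt0 ?expR_gt0 // exprn_gt0.
(* The height m of the bumps: below ka for the inequality at a contact, below c for strict order at
   time 1. *)
pose m := Num.min ka (c / 2).
have m0 : 0 < m by rewrite lt_min ka0 divr_gt0.
have mka : m <= ka by rewrite ge_min lexx.
have mc : m <= c / 2 by rewrite ge_min lexx orbT.
pose A := m / G.
have A0 : 0 < A by rewrite divr_gt0.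
have AG : A * G = m by rewrite divfK // gt_eqF.
have e0 : 0 < A * L ^+ 6 by rewrite mulr_gt0 // exprn_gt0.
have em : A * L ^+ 6 <= m.
  rewrite -AG ler_pM2l // /G ler_peMl ?exprn_ge0 ?(ltW L0) //.
  have := expR_ge1Dx ((L ^+ 2 + 4) / 4); have := sqr_ge0 L; lin.
exists (A * L ^+ 6); first by rewrite e0 /=; lin.
move=> t x t1 xt; have t0 : 0 < t by exact: lt_le_trans t1.
pose b := t^-1 *: x.
have xb : x = t *: b by rewrite scalerA divff ?scale1r // gt_eqF.
have nb : enorm b <= c1 by rewrite /b enormZ gtr0_norm ?invr_gt0 // ler_pdivrMl // mulrC.
have b2 : enorm b <= 2 by lin.
have bb : dot b b <= c1 ^+ 2 by rewrite -enorm_le.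
have bumpm s y : 0 < s -> bump A 0 L b s y <= m.
  move=> s0; apply: le_trans (bump_le _ _ A0 (lexx 0) (ltW s0) (ltW L0)) _.
  rewrite -AG -mulrA ler_pM2l // ler_pM2r ?exprn_gt0 // ler_expR; lin.
have bumpr s y : 0 < s -> 0 < bump A 0 L b s y -> enorm y < L + 2 * s.
  move=> s0 /(bump_gt0 A0); rewrite (gtr0_norm L0) => H.
  have := enormB_ge y (s *: b); rewrite enormZ (gtr0_norm s0).
  have : s * enorm b <= s * 2 by rewrite ler_pM2l.
  lin.
have rw := parabolic_regularD ru (parabolic_regularN (bump_regular A 0 L b)).
suff : 0 < u t x - bump A 0 L b t x.
  by rewrite {2}xb bump_at_center mul0r oppr0 expR0 mulr1 subr_gt0 => /ltW.
have bumple0 s y : 0 < s -> bump A 0 L b s y <= 0 -> 0 < u s y - bump A 0 L b s y.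
  by move=> s0 H; have := solution_gt0 y s0; lin.
apply: (comparison_gt0 ltr01 rw (T1 := t) (r := L + 2 * t)); last by rewrite t1 lexx.
- move=> y; have [|bp] := lerP (bump A 0 L b 1 y) 0; first exact: bumple0.
  have yL : dot y y <= (L + 2) ^+ 2.
    by rewrite -enorm_le; [have := bumpr 1 y ltr01 bp; lin|lin].
  have := clow y yL; have := bumpm 1 y ltr01; lin.
- move=> s y /andP[s1 st] Ly; have s0 : 0 < s by exact: lt_le_trans s1.
  apply: bumple0 => //; rewrite leNgt; apply/negP => /(bumpr s y s0).
  have := norm_le_enorm y; lin.
- move=> s y /andP[s1 st] w0 wt0 w20; have s0 : 0 < s by exact: lt_trans s1.
  have us := solution_gt0 y s0.
  have bu : bump A 0 L b s y = u s y by lin.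
  have bp : 0 < bump A 0 L b s y by rewrite bu.
  have q0 : 0 < L ^+ 2 - (dot y y - 2 * s * dot y b + s ^+ 2 * dot b b).
    rewrite bump_center subr_gt0 -sqr_enorm ltr_pXn2r ?nnegrE ?enorm_ge0 ?(ltW L0) //.
    by have := bump_gt0 A0 bp; rewrite (gtr0_norm L0).
  have := bump_subsolution 0 A0 q0 hka.
  set S1 := \sum_i _; have HS : S1 <= \sum_i dx i (dx i u) s y.
    by apply: ler_sum => i _; rewrite -subr_ge0; exact: w20.
  move: wt0; rewrite eu // bu subr0.
  have um : u s y <= m by rewrite -bu; exact: bumpm.
  have -> : logistic (u s y) = u s y * (1 - u s y).
    by rewrite /logistic ifT //; apply/andP; split; lin.
  have : 0 < u s y * (1 - u s y - (dot b b / 4 + ka)) by rewrite mulr_gt0 //; lin.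
  move: HS; move: S1 (\sum_i _) => S1 S2; move: (_ * (_ + _) : R) => X.
  lin.
Qed.

End solution_lower.

Section paraboloid.
Context {R : realType} {n : nat}.

(* [a + k t - q |x - c|^2], expanded as in [paraboloid_center]. *)
Definition paraboloid (a k q : R) (c : 'rV[R]_n) (t : R) (x : 'rV[R]_n) : R :=
  a + k * t - q * (dot x x - 2 * dot x c + dot c c).

Lemma paraboloid_center (x c : 'rV[R]_n) : dot x x - 2 * dot x c + dot c c = dot (x - c) (x - c).
Proof. rewrite dotDl !dotDr !dotNl !dotNr [dot c x]dotC; ring. Qed.

Lemma parabolic_paraboloid (a k q : R) (c : 'rV[R]_n) :
  parabolic_regular (paraboloid a k q c) (fun _ _ => k)
    (fun i _ x => - q * (2 * x 0 i - 2 * c 0 i)) (fun _ _ _ => - (2 * q)).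
Proof.
split.
- by move=> t x _; rewrite /paraboloid; cont.
- by move=> t x _; rewrite /paraboloid; derive; ring.
- move=> i t x _; rewrite /paraboloid.
  under eq_fun do rewrite sqdot_line dot_line; derive; ring.
- move=> i t x _.
  under eq_fun do rewrite coord_line; derive; ring.
Qed.

End paraboloid.

Section solution_invades.
Context {R : realType} {n : nat}.
Local Notation fld := (R -> 'rV[R]_n -> R).
Local Notation RT := (measurableTypeR R).
Context {u : fld} {u0 : 'rV[R]_n -> R}.
Hypothesis hu : bounded_classical_solution logistic u0 u.
Hypothesis mu0 : measurable_fun [set: n.-tuple RT] (u0 \o row_of_tuple).
Hypothesis u0_ge0 : forall x, 0 <= u0 x.
Hypothesis u0_near0 : exists2 r0 : R, 0 < r0 & forall x, `|x| <= r0 -> 1 <= u0 x.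

Lemma logistic_ge (e l s : R) : 0 < e -> e <= s <= l -> l < 1 -> e * (1 - l) <= logistic s.
Proof.
move=> e0 /andP[es sl] l1; rewrite /logistic ifT; last by apply/andP; split; lin.
by apply: ler_pM; lin.
Qed.

(** For c < c1 < 2, u >= e holds on a ball around x of any fixed radius during [t - S, t] once t is
    large. A paraboloid centred at x, supported below 0 outside that ball, rises there from e / 2 to
    l > la, driven by the lower bound f0 of the reaction on [e, l]. *)
Lemma solution_invades (c la : R) : 0 <= c < 2 -> 0 < la < 1 ->
  exists2 T : R, 0 < T & forall t x, T <= t -> enorm x <= c * t -> la < u t x.
Proof.
move=> /andP[c0 c2] /andP[la0 la1].
pose c1 := (c + 2) / 2.
have c12 : 0 <= c1 < 2 by rewrite /c1; apply/andP; split; lin.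
have [e /andP[e0 e12] He] := solution_spreads hu mu0 u0_ge0 u0_near0 c12.
pose l := (1 + la) / 2.
have l1 : l < 1 by rewrite /l; lin.
have l12 : 1 / 2 < l by rewrite /l; lin.
have lal : la < l by rewrite /l; lin.
pose f0 := e * (1 - l).
have f00 : 0 < f0 by rewrite mulr_gt0 // subr_gt0.
pose k := f0 / 2.
have k0 : 0 < k by rewrite divr_gt0.
have n0 : (0 : R) <= n%:R by [].
(* Makes 2 n q <= f0 / 4; together with k = f0 / 2 the paraboloid is then a strict subsolution of
   v_t = Lap v + f0. *)
pose w := 8 * n%:R * l / f0.
have w0 : 0 <= w by rewrite divr_ge0 ?(ltW f00) // mulr_ge0 ?mulr_ge0 //; lin.
pose r2 := w + 1.
have r21 : 1 <= r2 by rewrite /r2; lin.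
(* r2 is a squared radius: the paraboloid, of height at most l, is nonpositive for |y - x|^2 >=
   r2. *)
pose q := l / r2.
have q0 : 0 < q by rewrite divr_gt0; lin.
have qr2 : q * r2 = l by rewrite divfK // gt_eqF //; lin.
have nq : 8 * n%:R * q <= f0.
  rewrite /q mulrA ler_pdivrMr; last lin.
  have : w * f0 = 8 * n%:R * l by rewrite divfK // gt_eqF.
  by rewrite /r2; nra.
pose S := (l - e / 2) / k.
have kS : k * S = l - e / 2 by rewrite mulrC divfK // gt_eqF.
have S0 : 0 < S by rewrite divr_gt0 //; lin.
pose g := (2 - c) / 2.
have g0 : 0 < g by rewrite /g; lin.
have T0 : 0 <= (r2 + 2 * S) / g by rewrite divr_ge0 //; lin.
(* The first term keeps the ball inside |y| <= c1 s for s in [t - S, t], as g = c1 - c; the others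
   give t - S >= 1. *)
exists ((r2 + 2 * S) / g + S + 1); first lin.
move=> t x tT xt.
pose t0 := t - S.
have t01 : 1 <= t0 by rewrite /t0; lin.
have t00 : 0 < t0 by lin.
have t0t : t0 <= t by rewrite /t0; lin.
have gt_ : r2 + 2 * S <= g * t by rewrite [g * t]mulrC -ler_pdivrMr //; lin.
pose a := e / 2 - k * t0.
have pE s y : paraboloid a k q x s y = e / 2 + k * (s - t0) - q * dot (y - x) (y - x).
  by rewrite /paraboloid paraboloid_center /a; ring.
have kst s : s <= t -> k * (s - t0) <= l - e / 2.
  by move=> st; rewrite -kS ler_pM2l // /t0; lin.
have out s y : s <= t -> r2 <= dot (y - x) (y - x) -> paraboloid a k q x s y <= 0.
  move=> st ry; rewrite pE; have := kst s st.
  have : q * r2 <= q * dot (y - x) (y - x) by rewrite ler_pM2l.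
  by rewrite qr2; lin.
have pl s y : s <= t -> paraboloid a k q x s y <= l.
  move=> st; rewrite pE; have := kst s st.
  have : 0 <= q * dot (y - x) (y - x) by rewrite mulr_ge0 ?dot_ge0 // ltW.
  lin.
have inn s y : t0 <= s -> dot (y - x) (y - x) < r2 -> e <= u s y.
  move=> s0 yr; apply: He; first lin.
  have : enorm (y - x) <= r2.
    by rewrite enorm_le ?(le_trans _ r21) //; exact: le_trans (ltW yr) (ler_eXnr _ r21).
  have := enormD_le (y - x) x; rewrite subrK.
  have : c1 * t0 <= c1 * s by rewrite ler_wpM2l //; case/andP: c12.
  have -> : c1 * t0 = c * t + g * t - c1 * S by rewrite /t0 /c1 /g; field.
  have : c1 * S <= 2 * S by rewrite ler_pM2r // ltW //; case/andP: c12.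
  lin.
have ru : parabolic_regular u (dt u) (fun i => dx i u) (fun i => dx i (dx i u)).
  by apply: class_C12_parabolic; case: hu.
have rw := parabolic_regularD ru (parabolic_regularN (parabolic_paraboloid a k q x)).
have pos s y : 0 < s -> 0 < u s y by exact: (solution_gt0 hu mu0 u0_ge0 u0_near0).
have H : 0 < u t x - paraboloid a k q x t x.
  apply: (comparison_gt0 t00 rw (T1 := t) (r := enorm x + r2)); last by rewrite t0t lexx.
  - move=> y; have [yo|yi] := lerP r2 (dot (y - x) (y - x)).
      by have := out _ _ t0t yo; have := pos t0 y t00; lin.
    rewrite pE subrr mulr0 addr0; have := inn _ _ (lexx t0) yi.
    have : 0 <= q * dot (y - x) (y - x) by rewrite mulr_ge0 ?dot_ge0 // ltW.
    lin.
  - move=> s y /andP[s0 st] yr; have sp : 0 < s by lin.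
    have yo : r2 <= dot (y - x) (y - x).
      have := enormB_ge y x; have := norm_le_enorm y => H1 H2.
      have H3 : r2 <= enorm (y - x) by lin.
      have H4 := le_trans r21 H3.
      by rewrite -sqr_enorm; apply: le_trans H3 _; exact: ler_eXnr.
    by have := out _ _ st yo; have := pos s y sp; lin.
  - move=> s y /andP[s0 st] w0' wt0 w20; have sp : 0 < s by lin.
    have up : u s y = paraboloid a k q x s y by lin.
    have yi : dot (y - x) (y - x) < r2.
      rewrite ltNge; apply/negP => yo.
      by have := out _ _ st yo; have := pos s y sp; rewrite up; lin.
    have lf : f0 <= logistic (u s y).
      apply: logistic_ge => //; rewrite inn //=; last exact: ltW.
      by rewrite up; exact: pl.
    have HS : - (2 * q) *+ n <= \sum_i dx i (dx i u) s y.
      rewrite -[X in _ *+ X](card_ord n) -sumr_const; apply: ler_sum => i _.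
      by rewrite -subr_ge0; exact: w20.
    have eu : dt u s y = \sum_i dx i (dx i u) s y + logistic (u s y).
      by case: hu => _ _ H _; exact: H.
    move: wt0 HS; rewrite eu -[_ *+ n]mulr_natr; move: (\sum_i _) => Z.
    move: lf; move: (logistic _) => F; rewrite /k.
    move: nq; rewrite (_ : 8 * n%:R * q = 4 * (2 * q * n%:R)); last ring.
    rewrite mulNr; move: (2 * q * n%:R) => Y; lin.
move: H; rewrite pE subrr [dot 0 _]big1 => [|i _]; last by rewrite mxE mul0r.
have -> : t - t0 = S by rewrite /t0 opprB addrC subrK.
rewrite kS mulr0; lin.
Qed.

End solution_invades.

(** * Decay outside the ball of radius 2 t *)

Section barriers.
Context {R : realType} {n : nat}.
Local Notation fld := (R -> 'rV[R]_n -> R).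

(** For |e| = 1 an exact solution of v_t = Lap v + v, whose level sets move at the critical speed
    2. *)
Definition plane_wave (k : R) (e : 'rV[R]_n) : fld := fun t x => expR (k + 2 * t - dot x e).

Lemma parabolic_plane_wave (k : R) (e : 'rV[R]_n) :
  parabolic_regular (plane_wave k e) (fun t x => 2 * plane_wave k e t x)
   (fun i t x => - e 0 i * plane_wave k e t x)
   (fun i t x => e 0 i ^+ 2 * plane_wave k e t x).
Proof.
split.
- by move=> t x _; rewrite /plane_wave; cont.
- by move=> t x _; rewrite /plane_wave; derive; ring.
- move=> i t x _; rewrite /plane_wave.
  under eq_fun do rewrite dot_line; derive.
  by rewrite !mul0r !addr0; ring.
- move=> i t x _; rewrite /plane_wave.
  under eq_fun do rewrite dot_line; derive.
  by rewrite !mul0r !addr0; ring.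
Qed.

(* [4 e^t sqrt (D / (t + D)) e^(- x_j^2 / (4 (t + D)))], a multiple of [e^t] times the heat
   kernel in the variable [x_j] started at time [D]. *)
Definition slab_wave (D : R) (j : 'I_n) : fld := fun t x =>
  4 * expR (t - x 0 j ^+ 2 / 4 * (t + D)^-1 - (ln (t + D) - ln D) / 2).

Lemma coord_line_neq (x : 'rV[R]_n) i j (s : R) :
  (x + s *: delta_mx 0 i) 0 j = x 0 j + s * (j == i)%:R.
Proof. by rewrite !mxE eqxx. Qed.

Lemma parabolic_slab_wave (D : R) (j : 'I_n) : 0 < D ->
  let V := slab_wave D j in
  let d i := (j == i)%:R : R in
  parabolic_regular V
   (fun t x => V t x * (1 + x 0 j ^+ 2 / 4 * (t + D) ^- 2 - (t + D)^-1 / 2))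
   (fun i t x => V t x * (- (x 0 j / 2 * (t + D)^-1) * d i))
   (fun i t x => V t x * (x 0 j ^+ 2 / 4 * (t + D) ^- 2 - (t + D)^-1 / 2) * d i ^+ 2).
Proof.
move=> D0 V d; split.
- move=> t x t0; have tD : 0 < t + D by rewrite addr_gt0.
  have c1 : cont_at (t, x) (fun p : R * 'rV[R]_n => p.1 + D) by do ?cont_step.
  have c2 : cont_at (t, x) (fun p : R * 'rV[R]_n => (p.1 + D)^-1).
    exact: (continuous_comp (c1 : {for (t, x), continuous _}) (inv_continuous (lt0r_neq0 tD))).
  have c3 : cont_at (t, x) (fun p : R * 'rV[R]_n => ln (p.1 + D)).
    exact: (continuous_comp (c1 : {for (t, x), continuous _}) (continuous_ln tD)).
  rewrite /V /slab_wave; cont => //.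
- move=> t x t0; have tD : 0 < t + D by rewrite addr_gt0.
  have d1 : is_derive t 1 (fun r => r + D) 1 by derive; ring.
  have d2 := @is_derive_ln _ (fun r => r + D) t _ tD d1.
  have d3 := @is_derive_inv _ (fun r => r + D) t _ (lt0r_neq0 tD) d1.
  rewrite /V /slab_wave; notypeclasses refine (is_derive_val _ _).
    by repeat (exact: d2 || exact: d3 || derive_step).
  cbv beta; field; by rewrite gt_eqF.
- move=> i t x t0; rewrite /V /slab_wave.
  under eq_fun do rewrite coord_line_neq; derive.
  by rewrite !mul0r !addr0 /d; field; rewrite gt_eqF // addr_gt0.
- move=> i t x t0; rewrite /V /slab_wave.
  under eq_fun do rewrite coord_line_neq; derive.
  by rewrite !mul0r !addr0 /d; field; rewrite gt_eqF // addr_gt0.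
Qed.

End barriers.

Lemma sqr_le_norm {R : realDomainType} (x r : R) : `|x| <= r -> x ^+ 2 <= r ^+ 2.
Proof.
move=> xr; rewrite -(real_normK (num_real x)) ler_pXn2r ?nnegrE //.
exact: le_trans xr.
Qed.

Section gaussian_slab.
Context {R : realType} {m : nat}.
Local Notation RT := (measurableTypeR R).
Local Notation E := 'rV[R]_(m + 1).
Local Notation U := (gaussian_slab R m).
Implicit Types x y : E.

Definition horiz x : R := dot (lsubmx x) (lsubmx x).
Definition vert x : R := x 0 (rshift m 0).

Lemma dot_horiz_vert x : dot x x = horiz x + vert x ^+ 2.
Proof.
rewrite /dot big_split_ord /= big_ord1 -expr2; congr (_ + _).
by apply: eq_bigr => i _; rewrite !mxE.
Qed.

Lemma horiz_ge0 x : 0 <= horiz x. Proof. exact: dot_ge0. Qed.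

Lemma gaussian_slabE x : U x <-> `|vert x| <= expR (- horiz x).
Proof. by rewrite /gaussian_slab /= mxE sqr_enorm. Qed.

Lemma continuous_slab_function : continuous (fun x => expR (- horiz x) - `|vert x|).
Proof.
move=> x; apply: (@cont_at_add _ _ (fun y => expR (- horiz y)) (fun y => - `|vert y|)).
  apply: cont_at_exp; apply: cont_at_opp; apply: cont_at_sum => i.
  rewrite (_ : (fun y => _) = fun y : E => y 0 (lshift 1 i) * y 0 (lshift 1 i)).
    by apply: cont_at_mul; exact: coord_continuous.
  by apply/funext => y; rewrite !mxE.
apply: cont_at_opp.
exact: (continuous_comp (@coord_continuous R 1 (m + 1) 0 (rshift m 0) x) (@norm_continuous _ _ (vert x))).
Qed.

Lemma measurable_slab :
  measurable_fun [set: (m + 1).-tuple RT] ((\1_U : E -> R) \o row_of_tuple).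
Proof.
rewrite (_ : _ \o _ = \1_(((fun x => expR (- horiz x) - `|vert x|) \o (@row_of_tuple R (m + 1)))
    @^-1` `[0, +oo[%classic)).
  apply: measurable_indic; rewrite -[X in measurable X]setTI.
  apply: (continuous_measurable_row continuous_slab_function) => //.
apply/funext => v /=; rewrite !indicE; congr ((nat_of_bool _)%:R).
by apply/idP/idP => /set_mem H; apply/mem_set; move: H;
  rewrite /= in_itv /= andbT subr_ge0 => /gaussian_slabE.
Qed.

Lemma slab_ge0 x : 0 <= (\1_U x : R).
Proof. by rewrite indicE. Qed.

Lemma slab_near0 : exists2 r0 : R, 0 < r0 & forall x, `|x| <= r0 -> 1 <= (\1_U x : R).
Proof.
(* If all coordinates are at most p / 2, then |x'|^2 <= m p / 4 <= 1 / 4 and |x_N| <= 1 / 2 <= 1 - 1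
   / 4. *)
have [p [p0 p1 pm]] : exists p : R, [/\ 0 < p, p <= 1 & p * m%:R <= 1].
  exists m.+1%:R^-1; split; rewrite ?invr_gt0 ?invf_le1 ?ler1n //.
  by rewrite mulrC ler_pdivrMr // mul1r ler_nat.
exists (p / 2); first by rewrite divr_gt0.
move=> x xr; rewrite indicE mem_set //; apply/gaussian_slabE.
have vx : `|vert x| <= p / 2 by apply: le_trans (coord_le_norm x _) xr.
have hx : horiz x <= 1 / 4.
  apply: (@le_trans _ _ (\sum_(i < m) p / 4)).
    apply: ler_sum => i _; rewrite !mxE -expr2.
    have := sqr_le_norm (le_trans (coord_le_norm x (lshift 1 i)) xr).
    nra.
  rewrite sumr_const card_ord -mulr_natr; lin.
by have := expR_ge1Dx (- horiz x); lin.
Qed.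

Context {u : R -> E -> R}.
Hypothesis hu : bounded_classical_solution logistic \1_U u.

(* The parts of the slab with [|x'| < k] and [|x'| >= k] are dominated at time 0 by the
   plane wave and by the slab wave with [D = e^2 (e^(- k^2))^2], respectively. *)
Lemma slab_solution_le (k t : R) (x e : E) : 0 <= k -> 1 <= t -> enorm e = 1 ->
  u t x <= expR (k + 2 + 2 * t - dot x e) + 4 * expR (t + 1 - k ^+ 2).
Proof.
move=> k0 t1 e1; have t0 : 0 < t by exact: lt_le_trans t1.
pose D : R := expR (2 * (1 - k ^+ 2)).
have D0 : 0 < D by exact: expR_gt0.
pose dl : R := expR (- k ^+ 2).
have dl0 : 0 < dl by exact: expR_gt0.
have dlD : 4 * dl ^+ 2 <= D.
  rewrite /D mulrBr mulr1 expRD; have -> : dl ^+ 2 = expR (- (2 * k ^+ 2)).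
    by rewrite /dl -expRM_natl mulrN.
  rewrite ler_pM2r ?expR_gt0 //.
  have -> : expR 2 = expR (1 : R) ^+ 2 by rewrite -expRM_natl mulr1.
  by have := expR_ge1Dx (1 : R); nra.
pose j : 'I_(m + 1) := rshift m 0.
(* The 2 in k + 2: one unit for the vertical coordinate of the slab, one for the diameter of the
   averaging cube. *)
have rV := parabolic_regularD (parabolic_plane_wave (k + 2) e) (parabolic_slab_wave j D0).
pose N : R := m.+1%:R.
have N1 : 1 <= N by rewrite ler1n.
have N0 : 0 < N by lin.
(* A side at most dl keeps |z_N| <= 2 dl; a side at most 1 / N keeps the Euclidean norm of cube
   points at most 1. *)
pose h1 := Num.min dl (N^-1).
have h10 : 0 < h1 by rewrite lt_min dl0 invr_gt0.
have e2 : \sum_i e 0 i ^+ 2 = 1.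
  by rewrite -[RHS](expr1n _ 2) -e1 sqr_enorm; apply: eq_bigr => i _; rewrite expr2.
have waves_ge0 s y : 0 <= plane_wave (k + 2) e s y /\ 0 <= slab_wave D j s y.
  by split; [exact: expR_ge0|rewrite mulr_ge0 // expR_ge0].
apply: (@le_trans _ _ (plane_wave (k + 2) e t x + slab_wave D j t x)).
  apply: (@solution_le_supersolution _ _ u _ hu measurable_slab slab_ge0 _ _ _ _ h1 rV) => //.
  - move=> s y s0; rewrite big_split /= -!mulr_suml -?mulr_sumr e2 mul1r.
    have -> : \sum_(i < m + 1) ((j == i)%:R : R) ^+ 2 = 1.
      rewrite (bigD1 j) //= eqxx expr1n big1 ?addr0 // => i ij.
      by rewrite eq_sym (negbTE ij) expr0n.
    by rewrite le_eqVlt; apply/orP; left; apply/eqP; ring.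
  - by move=> s y _; have [? ?] := waves_ge0 s y; exact: addr_ge0.
  move=> h /andP[h0]; rewrite le_min => /andP[hdl hN].
  (* For s < D the logarithm of (s + D) / D is at most 1, so the slab wave has not yet decayed
     much. *)
  exists D => // s z y /andP[s0 sD] hy.
  have [w1 w2] := waves_ge0 s z.
  rewrite indicE; have [/set_mem/gaussian_slabE Uzy|_] := boolP (z + y \in U); last by rewrite addr_ge0.
  rewrite -[true%:R]/(1 : R).
  have yj i : 0 <= y 0 i <= h by have := hy i; rewrite /= in_itv.
  have [kh|kh] := lerP (k ^+ 2) (horiz (z + y)).
  - apply: ler_wpDl => //.
    have zd : `|vert z| <= 2 * dl.
      have -> : vert z = vert (z + y) - vert y by rewrite /vert !mxE addrK.
      apply: le_trans (ler_normB _ _) _.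
      have : `|vert (z + y)| <= dl by apply: le_trans Uzy _; rewrite ler_expR lerN2.
      have /andP[y0 yh] := yj j; rewrite [`|vert y|]ger0_norm // /vert -/j; lin.
    have z2 : vert z ^+ 2 <= D.
      by apply: le_trans dlD; have := sqr_le_norm zd; rewrite exprMn; lin.
    have sDp : 0 < s + D by rewrite addr_gt0.
    have q1 : vert z ^+ 2 / 4 * (s + D)^-1 <= 1 / 4.
      by rewrite ler_pdivrMr //; have := ltW s0; lin.
    have q2 : ln (s + D) - ln D <= 1.
      rewrite -ln_div ?posrE //.
      have -> : (s + D) / D = 1 + s / D by rewrite mulrDl divff ?gt_eqF // addrC.
      have sD0 : 0 < s / D by rewrite divr_gt0.
      apply: le_trans (le_ln1Dx _) _; first lin.
      by rewrite ler_pdivrMr // mul1r ltW.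
    (* The exponent is at least - 1 / 4 - 1 / 2, and 4 (1 - 3 / 4) = 1: this fixes the factor 4. *)
    rewrite /slab_wave -/(vert z).
    have := expR_ge1Dx (s - vert z ^+ 2 / 4 / (s + D) - (ln (s + D) - ln D) / 2); lin.
  - apply: ler_wpDr => //; apply: (@le_trans _ _ (expR 0)); first by rewrite expR0.
    rewrite ler_expR.
    have v1 : vert (z + y) ^+ 2 <= 1.
      rewrite -(expr1n _ 2); apply: sqr_le_norm; apply: le_trans Uzy _.
      by rewrite -expR0 ler_expR oppr_le0 horiz_ge0.
    have nzy : enorm (z + y) <= k + 1.
      rewrite enorm_le; last lin.
      by rewrite dot_horiz_vert; nra.
    have ny : enorm y <= 1.
      rewrite enorm_le // expr1n; apply: (@le_trans _ _ (\sum_(i < m + 1) N^-1)).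
        apply: ler_sum => i _; have /andP[y0 yh] := yj i.
        have yN : y 0 i <= N^-1 by exact: le_trans yh hN.
        have Ni : N^-1 <= 1 by rewrite invf_le1.
        by rewrite -[leRHS]mulr1; apply: ler_pM => //; exact: le_trans yN Ni.
      by rewrite sumr_const card_ord -mulr_natr addn1 mulVf // gt_eqF.
    have := dot_le_enorm z e; rewrite e1 mulr1.
    have := enormB_ge (z + y) y; have := enormD_le (z + y) (- y); rewrite addrK enormN; lin.
(* For t >= 1 the dropped terms have a favourable sign, and (ln D) / 2 = 1 - k^2. *)
apply: lerD; first exact: lexx.
rewrite /slab_wave ler_pM2l // ler_expR /D expRK.
have : 0 <= ln (t + expR (2 * (1 - k ^+ 2))) by apply: ln_ge0; have := ltW D0; rewrite -/D; lin.
have : 0 <= x 0 j ^+ 2 / 4 / (t + expR (2 * (1 - k ^+ 2))).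
  by rewrite divr_ge0 ?divr_ge0 ?sqr_ge0 // addr_ge0 ?expR_ge0 // ltW.
lin.
Qed.

End gaussian_slab.

Section slab_decay.
Context {R : realType} {m : nat}.
Local Notation E := 'rV[R]_(m + 1).
Context {u : R -> E -> R}.
Hypothesis hu : bounded_classical_solution logistic \1_(gaussian_slab R m) u.

Lemma expRN_le (y : R) : 0 <= y -> expR (- y) <= (1 + y)^-1.
Proof.
move=> y0; rewrite expRN lef_pV2 ?posrE ?expR_gt0 //; last lra.
exact: expR_ge1Dx.
Qed.

(** With c = 2 + 2 a and k = a t, the two exponents are at most 2 - a t and t + 1 - (a t)^2, which
    both tend to minus infinity. *)
Lemma slab_solution_decays (c la : R) : 2 < c -> 0 < la -> exists2 T : R, 0 < T &
  forall t (x : E), T <= t -> c * t <= enorm x -> u t x < la.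
Proof.
move=> c2 la0; pose a := (c - 2) / 2.
have a0 : 0 < a by rewrite /a; lra.
(* Each exponential falls below la / 8, and the sum carries the weights 1 and 4. *)
pose Y := 8 / la.
have Y0 : 0 < Y by rewrite divr_gt0.
have YE (z : R) : Y <= z -> expR (- z) < la / 8.
  move=> Yz; apply: le_lt_trans (expRN_le _) _; first lra.
  have lY : la / 8 = Y^-1 by rewrite /Y invf_div.
  rewrite lY ltf_pV2 ?posrE //; lra.
have T1 : 0 < (Y + 2) / a by rewrite divr_gt0 //; lra.
have T2 : 0 < (Y + 2) / a ^+ 2 by rewrite divr_gt0 ?exprn_gt0 //; lra.
exists (1 + (Y + 2) / a + (Y + 2) / a ^+ 2); first lra.
move=> t x tT xt.
have t1 : 1 <= t by lra.
have xn0 : 0 < enorm x by apply: lt_le_trans xt; rewrite mulr_gt0; lra.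
pose e := (enorm x)^-1 *: x.
have e1 : enorm e = 1 by rewrite enormZ gtr0_norm ?invr_gt0 // mulVf // gt_eqF.
have xe : dot x e = enorm x.
  by rewrite dotZr -sqr_enorm expr2 mulrA mulVf ?mul1r // gt_eqF.
have at_ : Y + 2 <= a * t by rewrite mulrC -ler_pdivrMr //; lra.
have at2 : Y + 2 <= a ^+ 2 * t by rewrite mulrC -ler_pdivrMr ?exprn_gt0 //; lra.
have at0 : 0 <= a * t by rewrite mulr_ge0 //; lra.
apply: le_lt_trans (slab_solution_le hu x at0 t1 e1) _.
have H1 : expR (a * t + 2 + 2 * t - dot x e) < la / 8.
  apply: le_lt_trans (YE (a * t - 2) _); last lra.
  by rewrite ler_expR xe; move: xt; rewrite (_ : c = 2 + 2 * a); [lra|rewrite /a; field].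
have H2 : expR (t + 1 - (a * t) ^+ 2) < la / 8.
  apply: le_lt_trans (YE ((a * t) ^+ 2 - t - 1) _); first by rewrite ler_expR; lra.
  rewrite exprMn; have : (Y + 2) * t <= a ^+ 2 * t * t by rewrite ler_wpM2r //; lra.
  have : Y + 2 <= (Y + 2) * t - 0 by nra.
  nra.
lra.
Qed.

End slab_decay.

(** * Hausdorff distances and geometry of the slab *)

Section hausdorff_bounds.
Context {R : realType} {n : nat}.
Local Notation E := 'rV[R]_n.
Implicit Types (A B : set E) (x y : E).

Lemma edist_set_ge x A (d : R) : (forall y, A y -> d <= enorm (y - x)) -> (d%:E <= edist_set x A)%E.
Proof. by move=> H; apply: le_ereal_inf_tmp => _ [y Ay <-]; rewrite lee_fin H. Qed.

Lemma edist_set_le x A y (d : R) : A y -> enorm (y - x) <= d -> (edist_set x A <= d%:E)%E.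
Proof.
move=> Ay yd; apply: (@le_trans _ _ (enorm (y - x))%:E); last by rewrite lee_fin.
by apply: ereal_inf_lbound; exists y.
Qed.

Lemma edist_set_ge0 x A : (0 <= edist_set x A)%E.
Proof. by apply: edist_set_ge => y _; exact: enorm_ge0. Qed.

Lemma edist_set_mem x A : A x -> edist_set x A = 0%E.
Proof.
move=> Ax; apply/eqP; rewrite eq_le edist_set_ge0 andbT.
by apply: (edist_set_le Ax); rewrite subrr enorm0.
Qed.

Lemma hausdorff_ge0 A B : (0 <= hausdorff A B)%E.
Proof. by rewrite /hausdorff le_max lexx. Qed.

Lemma hausdorff_ger A B y (d : R) : B y -> (forall x, A x -> d <= enorm (x - y)) ->
  (d%:E <= hausdorff A B)%E.
Proof.
move=> By H; rewrite /hausdorff !le_max; apply/orP; right; apply/orP; right.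
apply: le_trans (edist_set_ge H) _.
by apply: ereal_sup_ubound; exists y.
Qed.

Lemma hausdorff_gel A B y (d : R) : A y -> (forall x, B x -> d <= enorm (x - y)) ->
  (d%:E <= hausdorff A B)%E.
Proof.
move=> By H; rewrite /hausdorff !le_max; apply/orP; right; apply/orP; left.
apply: le_trans (edist_set_ge H) _.
by apply: ereal_sup_ubound; exists y.
Qed.

Lemma hausdorff_le A B (d : R) : 0 <= d ->
  (forall x, A x -> exists2 y, B y & enorm (y - x) <= d) ->
  (forall y, B y -> exists2 x, A x & enorm (x - y) <= d) ->
  (hausdorff A B <= d%:E)%E.
Proof.
move=> d0 AB BA; rewrite /hausdorff !ge_max lee_fin d0 /=; apply/andP; split.
  by apply: ge_ereal_sup => _ [x Ax <-]; have [y By xy] := AB x Ax; exact: edist_set_le xy.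
by apply: ge_ereal_sup => _ [y By <-]; have [x Ax xy] := BA y By; exact: edist_set_le xy.
Qed.

End hausdorff_bounds.

Section ereal_limits.
Context {R : realType} {T : Type} {F : set_system T}.

Lemma cvge0_near_le {FF : Filter F} (f : T -> \bar R) :
  (forall e : R, 0 < e -> \forall t \near F, (0 <= f t <= e%:E)%E) -> f @ F --> 0%E.
Proof.
move=> H; apply/fine_cvgP; split.
  near=> t; have /andP[f0 f1] : (0 <= f t <= 1%:E)%E by near: t; exact: H.
  by rewrite ge0_fin_numE //; apply: le_lt_trans f1 _; rewrite ltry.
apply/cvgrPdist_le => e e0; near=> t; rewrite sub0r normrN.
have /andP[f0 f1] : (0 <= f t <= e%:E)%E by near: t; exact: H.
rewrite ger0_norm ?fine_ge0 //= -lee_fin fineK // ge0_fin_numE //.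
by apply: le_lt_trans f1 _; rewrite ltry.
Unshelve. all: end_near. Qed.

Lemma not_cvge0 {FF : ProperFilter F} (f : T -> \bar R) (d : R) : 0 < d ->
  (\forall t \near F, (d%:E <= f t)%E) -> ~ (f @ F --> 0%E).
Proof.
move=> d0 H /cvge0_near_lt /(_ d0) H2.
by have [t [/le_lt_trans h /h]] := filter_ex (filterI H H2); rewrite ltxx.
Qed.

Lemma not_cvge1 {FF : ProperFilter F} (f : T -> \bar R) :
  (\forall t \near F, (f t <= (1 / 2)%:E)%E) -> ~ (f @ F --> 1%E).
Proof.
move=> H fc; have /(_ FF) := cvge_to_le fc H.
by rewrite lee_fin; lra.
Qed.

End ereal_limits.

Lemma near_pinfty_ge {R : realType} (T : R) (P : R -> Prop) :
  (forall t, T <= t -> P t) -> \forall t \near +oo%R, P t.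
Proof. by move=> H; exists T; split; [exact: num_real|move=> t /ltW /H]. Qed.

Lemma enorm_subC {R : realType} {n : nat} (x y : 'rV[R]_n) : enorm (x - y) = enorm (y - x).
Proof. by rewrite -enormN opprB. Qed.

(** * Directions, boundary and inner parts of the slab *)

Section slab_geometry.
Context {R : realType} {m : nat}.
Local Notation E := 'rV[R]_(m + 1).
Local Notation U := (gaussian_slab R m).
Hypothesis hm : (2 <= m + 1)%N.
Implicit Types x y : E.

Lemma vert0_slab x : vert x = 0 -> U x.
Proof. by move=> v0; apply/gaussian_slabE; rewrite v0 normr0 expR_ge0. Qed.

Lemma vertZ (c : R) x : vert (c *: x) = c * vert x.
Proof. by rewrite /vert mxE. Qed.

Lemma vertD x y : vert (x + y) = vert x + vert y.
Proof. by rewrite /vert mxE. Qed.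

Lemma vert_le_enorm x : `|vert x| <= enorm x.
Proof. by apply: le_trans (coord_le_norm x _) (norm_le_enorm x). Qed.

Definition eN : E := delta_mx 0 (rshift m 0).

Lemma vert_eN : vert eN = 1. Proof. by rewrite /vert mxE !eqxx. Qed.

Lemma enorm_eN : enorm eN = 1.
Proof. by rewrite /enorm dot_delta mxE !eqxx sqrtr1. Qed.

(** Dimension at least 2 enters here: U contains the whole line spanned by such a vector. *)
Lemma horizontal_unit : exists2 e : E, enorm e = 1 & vert e = 0.
Proof.
have m0 : (0 < m)%N by move: hm; rewrite addn1 ltnS.
exists (delta_mx 0 (lshift 1 (Ordinal m0))); first by rewrite /enorm dot_delta mxE !eqxx sqrtr1.
by rewrite /vert mxE eq_rlshift andbF.
Qed.

Lemma interior_slab0 : interior U 0.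
Proof.
have [r r0 H] := @slab_near0 R m; apply/nbhs_ballP; exists r => // y.
rewrite -ball_normE /= sub0r normrN => /ltW /H; rewrite indicE.
have [/set_mem//|_] := boolP (y \in U).
by rewrite -[false%:R]/(0 : R) ler10.
Qed.

Lemma unbounded_horizontal e : enorm e = 1 -> vert e = 0 -> unbounded_directions U e.
Proof.
move=> e1 e0; split => //.
rewrite (_ : (fun tau => _) = fun=> 0%E); first exact: cvg_cst.
apply/funext => tau; rewrite edist_set_mem ?mul0e //.
by apply: vert0_slab; rewrite vertZ e0 mulr0.
Qed.

Lemma not_bounded_horizontal e : vert e = 0 -> ~ bounded_directions U e.
Proof.
move=> e0 [_]; rewrite (_ : (fun tau => _) = fun=> 0%E); last first.
  apply/funext => tau; rewrite edist_set_mem ?mul0e //.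
  by apply: vert0_slab; rewrite vertZ e0 mulr0.
rewrite limf_einfE ltNge => /negP; apply; apply: ge_ereal_sup => _ [V FV <-].
have [t Vt] := filter_ex FV.
by apply: ereal_inf_lbound; exists t.
Qed.

Lemma slab_boundary x : vert x = expR (- horiz x) -> boundary U x.
Proof.
move=> vx; split.
  by apply: subset_closure; apply/gaussian_slabE; rewrite vx ger0_norm // expR_ge0.
rewrite /interior => /nbhs_ballP[r /= r0 Hr].
have /gaussian_slabE : U (x + (r / 2) *: eN).
  apply: Hr; rewrite -ball_normE /= opprD addrA subrr add0r normrN.
  apply: le_lt_trans (norm_le_enorm _) _; rewrite enormZ enorm_eN mulr1 gtr0_norm; last lra.
  lra.
have -> : horiz (x + (r / 2) *: eN) = horiz x.
  apply: eq_bigr => i _; rewrite !mxE eq_lrshift andbF mulr0 addr0 //.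
rewrite vertD vertZ vert_eN mulr1 -vx.
have := expR_ge0 (- horiz x); rewrite -vx => v0.
by rewrite ger0_norm; lra.
Qed.

(** The boundary point on the vertical line through x lies within 2 e^(- |x'|^2), so distance at
    least rho to the boundary bounds |x'|. Both conditions fail because U itself is unbounded. *)
Lemma interior_part_bounded (rho : R) : 0 < rho -> exists B : R,
  forall x, interior_part U rho x -> enorm x <= B.
Proof.
move=> r0; exists (1 + 2 / rho) => x [/gaussian_slabE Ux dx].
pose y := x + (expR (- horiz x) - vert x) *: eN.
have hy : horiz y = horiz x.
  by apply: eq_bigr => i _; rewrite !mxE eq_lrshift andbF mulr0 addr0.
have By : boundary U y.
  by apply: slab_boundary; rewrite hy vertD vertZ vert_eN mulr1 addrC subrK.
have : rho <= 2 * expR (- horiz x).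
  have := le_trans dx (@edist_set_le _ _ x _ y _ By (lexx _)); rewrite lee_fin.
  rewrite /y addrAC subrr add0r enormZ enorm_eN mulr1 => H; apply: le_trans H _.
  by apply: le_trans (ler_normB _ _) _; rewrite ger0_norm ?expR_ge0 //; lra.
have h0 := horiz_ge0 x.
have H1 := expRN_le h0.
have i0 : 0 < 1 + horiz x by lra.
move=> H2; have : rho * (1 + horiz x) <= 2.
  rewrite -ler_pdivlMr //; lra.
rewrite mulrC -ler_pdivlMr // => H3.
have q0 : 0 < 2 / rho by rewrite divr_gt0.
rewrite enorm_le; last lra.
have v1 : vert x ^+ 2 <= 1.
  rewrite -(expr1n _ 2); apply: sqr_le_norm; apply: le_trans Ux _.
  by rewrite -expR0 ler_expR oppr_le0.
rewrite dot_horiz_vert; nra.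
Qed.

Lemma slab_not_G (rho : R) : 0 < rho -> ~ condition_G U rho.
Proof.
move=> r0 G; have [e e1 e0] := horizontal_unit.
have [B HB] := interior_part_bounded r0.
have : usphere e by [].
rewrite -G => -[/not_bounded_horizontal//|[_]].
apply: (@not_cvge0 _ _ _ _ _ (1 / 2)); first lra.
apply: (@near_pinfty_ge _ (2 * `|B| + 1)) => t tB.
have B0 := normr_ge0 B; have BB := ler_norm B.
have t0 : 0 < t by lra.
have D : ((t - B)%:E <= edist_set (t *: e) (interior_part U rho))%E.
  apply: edist_set_ge => y /HB yB.
  have := enormB_ge (t *: e) y; rewrite enorm_subC enormZ e1 mulr1 gtr0_norm //; lra.
apply: (@le_trans _ _ ((t - B)%:E * (t^-1)%:E)%E).
  by rewrite -EFinM lee_fin ler_pdivlMr //; lra.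
by apply: lee_wpmul2r D; rewrite lee_fin invr_ge0 ltW.
Qed.

Lemma slab_not_D (rho : R) : 0 < rho -> ~ condition_D U rho.
Proof.
move=> r0; rewrite /condition_D => D; have [e e1 e0] := horizontal_unit.
have [B HB] := interior_part_bounded r0.
have H (t : R) : 0 < t -> ((t - B)%:E <= hausdorff U (interior_part U rho))%E.
  move=> t0; apply: (@hausdorff_gel _ _ _ _ (t *: e)).
    by apply: vert0_slab; rewrite vertZ e0 mulr0.
  move=> y /HB yB.
  have := enormB_ge (t *: e) y; rewrite enorm_subC enormZ e1 mulr1 gtr0_norm //; lra.
have fin : hausdorff U (interior_part U rho) \is a fin_num.
  by rewrite ge0_fin_numE // hausdorff_ge0.
move: H; rewrite -(fineK fin); set d := fine _ => H.
have := H (`|d| + `|B| + 1); rewrite lee_fin => /(_ _)/wrap[].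
  have := normr_ge0 d; have := normr_ge0 B; lra.
have := ler_norm d; have := ler_norm B; lra.
Qed.

Lemma speed_horizontal e : enorm e = 1 -> vert e = 0 -> spreading_speed U e = +oo%E.
Proof.
move=> e1 e0; rewrite /spreading_speed ifT //.
by apply/asboolP; exact: unbounded_horizontal.
Qed.

End slab_geometry.

(** * Failure of the five properties and the two Hausdorff limits *)

Section slab_asymptotics.
Context {R : realType} {m : nat}.
Local Notation E := 'rV[R]_(m + 1).
Local Notation U := (gaussian_slab R m).
Hypothesis hm : (2 <= m + 1)%N.
Context {u : R -> E -> R}.
Hypothesis hu : bounded_classical_solution logistic \1_U u.
Implicit Types x y : E.

Lemma slab_invades (c la : R) : 0 <= c < 2 -> 0 < la < 1 ->
  exists2 T : R, 0 < T & forall t x, T <= t -> enorm x <= c * t -> la < u t x.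
Proof. exact: (solution_invades hu measurable_slab slab_ge0 slab_near0). Qed.

Lemma superlevel_subset (la : R) : 0 < la -> exists2 T : R, 0 < T &
  forall t x, T <= t -> superlevel u la t x -> enorm x < 3 * t.
Proof.
move=> la0; have [|T T0 H] := slab_solution_decays hu (_ : 2 < 3) la0; first lra.
exists T => // t x tT ux; rewrite ltNge; apply/negP => /(H t x tT).
by move: ux; rewrite /superlevel /= => /lt_trans h /h; rewrite ltxx.
Qed.

(** Speed 3 stands for any speed above 2. In a horizontal direction w is infinite, so (i), (ii) and
    (iii) predict values near 1 at distance 3 t. *)
Lemma slab_small_far : exists2 T : R, 0 < T &
  forall t x, T <= t -> 3 * t <= enorm x -> u t x <= 1 / 2.
Proof.
have [T T0 H] := @slab_solution_decays _ _ _ hu 3 (1 / 2) (ltac:(lra)) (ltac:(lra)).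
by exists T => // t x tT xt; apply/ltW/H.
Qed.

Lemma slab_not_i : ~ property_i U u.
Proof.
have [e e1 e0] := horizontal_unit (R := R) hm; have [T T0 H] := slab_small_far.
move=> /(_ e e1)[+ _]; rewrite (speed_horizontal e1 e0) => /(_ 3)/(_ _ (ltry _))/wrap[]; first lra.
move=> /cvgrPdist_lt /(_ (1 / 2)) /(_ _)/wrap[]; first lra.
move=> Hc; have [t [tT Ht]] := filter_ex (filterI (near_pinfty_ge (T := T) (P := fun t => T <= t) (fun t h => h)) Hc).
have t0 : 0 < t by lra.
have := H t ((3 * t) *: e) tT; rewrite enormZ e1 mulr1 gtr0_norm; last lra.
by move=> /(_ (lexx _)); move: Ht; rewrite ltr_norml => /andP[]; lra.
Qed.

Lemma slab_not_ii : ~ property_ii U u.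
Proof.
have [e e1 e0] := horizontal_unit (R := R) hm; have [T T0 H] := slab_small_far.
move=> /(_ e e1)[+ _]; rewrite (speed_horizontal e1 e0) => /(_ 3)/(_ _ (ltry _))/wrap[]; first lra.
apply: not_cvge1; apply: (@near_pinfty_ge _ T) => t tT.
have t0 : 0 < t by lra.
apply: (@le_trans _ _ (u t ((3 * t) *: e))%:E).
  by apply: ereal_inf_lbound; exists 3 => //=; apply/andP; split; lra.
by rewrite lee_fin H // enormZ e1 mulr1 gtr0_norm //; lra.
Qed.

Lemma horizontal_spreading e (r : R) : enorm e = 1 -> vert e = 0 -> 0 <= r ->
  spreading_set U (r *: e).
Proof. by move=> e1 e0 r0; exists e, r; split => //; rewrite speed_horizontal // ltry. Qed.

Lemma slab_not_iii : ~ property_iii U u.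
Proof.
have [e e1 e0] := horizontal_unit (R := R) hm; have [T T0 H] := slab_small_far.
move=> /(_ [set 3 *: e] (@compact_set1 _ _)) /(_ _)/wrap[]; first by exists (3 *: e).
move=> [+ _] => /(_ _)/wrap[]; first by move=> _ ->; apply: horizontal_spreading => //; lra.
apply: not_cvge1; apply: (@near_pinfty_ge _ T) => t tT.
have t0 : 0 < t by lra.
apply: (@le_trans _ _ (u t (t *: (3 *: e)))%:E).
  by apply: ereal_inf_lbound; exists (3 *: e).
by rewrite lee_fin H // scalerA enormZ e1 mulr1 gtr0_norm; lra.
Qed.

(** The point 5 e lies in the spreading set and in the ball of radius 10, while the rescaled
    superlevel sets stay in the ball of radius 3. *)
Lemma slab_not_iv : ~ property_iv U u.
Proof.
have [e e1 e0] := horizontal_unit (R := R) hm.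
have [|T T0 H] := @superlevel_subset (1 / 2); first lra.
move=> /(_ 10 (1 / 2)) /(_ (ltac:(lra)) (ltac:(apply/andP; split; lra))).
apply: (@not_cvge0 _ _ _ _ _ 1); first lra.
apply: (@near_pinfty_ge _ T) => t tT; have t0 : 0 < t by lra.
apply: (@hausdorff_ger _ _ _ _ (5 *: e)).
  split; last by apply: horizontal_spreading => //; lra.
  by apply: subset_closure; rewrite /eball /= subr0 enormZ e1 mulr1 gtr0_norm; lra.
move=> _ [_ [z uz <-]].
have zt : enorm (t^-1 *: z) < 3.
  by rewrite enormZ gtr0_norm ?invr_gt0 // mulrC ltr_pdivrMr //; exact: H.
have := enormB_ge (5 *: e) (t^-1 *: z).
rewrite enorm_subC [enorm (5 *: e)]enormZ e1 mulr1 gtr0_norm; lra.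
Qed.

(** U contains the points 10 t e and the superlevel sets stay within 3 t of the origin: the gap is
    linear in t. *)
Lemma slab_not_v : ~ property_v U u.
Proof.
have [e e1 e0] := horizontal_unit (R := R) hm.
have [|T T0 H] := @superlevel_subset (1 / 2); first lra.
move=> /(_ (1 / 2)) /(_ (ltac:(apply/andP; split; lra))).
apply: (@not_cvge0 _ _ _ _ _ 7); first lra.
apply: (@near_pinfty_ge _ T) => t tT; have t0 : 0 < t by lra.
have : ((7 * t)%:E <= hausdorff (superlevel u (1 / 2) t) (minkowski_sum U (eball 0 (cstar * t))))%E.
  apply: (@hausdorff_ger _ _ _ _ ((10 * t) *: e)).
    exists ((10 * t) *: e); first by apply: vert0_slab; rewrite vertZ e0 mulr0.
    exists 0; last by rewrite addr0.
    by rewrite /eball /= subr0 enorm0 mulr_gt0.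
  move=> z /(H t z tT) zt.
  have := enormB_ge ((10 * t) *: e) z.
  rewrite enorm_subC !enormZ e1 mulr1 gtr0_norm; lra.
have ti : (0 <= (t^-1)%:E)%E by rewrite lee_fin invr_ge0 ltW.
by move=> /(lee_wpmul2r ti); rewrite -EFinM mulfK // gt_eqF.
Qed.

Lemma superlevel_limit (la : R) : 0 < la < 1 ->
  hausdorff (scale_set t^-1 (superlevel u la t)) (eball 0 2) @[t --> +oo%R] --> 0%E.
Proof.
move=> la01; apply: cvge0_near_le => e e0.
pose d := Num.min e 1.
have d0 : 0 < d by rewrite lt_min e0 ltr01.
have de : d <= e by rewrite ge_min lexx.
have d1 : d <= 1 by rewrite ge_min lexx orbT.
have [|T1 T10 H1] := @slab_invades (2 - d) la _ la01; first by apply/andP; split; lra.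
have [T2 T20 H2] := @slab_solution_decays _ _ _ hu (2 + d) la (ltac:(lra)) (andP la01).1.
apply: (@near_pinfty_ge _ (T1 + T2)) => t tT.
have t0 : 0 < t by lra.
rewrite hausdorff_ge0 /=; apply: hausdorff_le; first exact: ltW.
- move=> _ [z uz <-]; pose x := t^-1 *: z.
  have zt : enorm z < (2 + d) * t.
    have t2 : T2 <= t by lra.
    rewrite ltNge; apply/negP => /(H2 t z t2).
    by move: uz; rewrite /superlevel /= => /lt_trans h /h; rewrite ltxx.
  have xn : enorm x < 2 + d.
    by rewrite enormZ gtr0_norm ?invr_gt0 // mulrC ltr_pdivrMr.
  have d2 : 0 < 2 + d by lra.
  (* The homothety from radius 2 + d to radius 2 moves points of the larger ball by at most d; in
     the other direction 1 - d / 2 maps radius 2 to radius 2 - d. *)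
  exists ((2 / (2 + d)) *: x).
    rewrite /eball /= subr0 enormZ gtr0_norm ?divr_gt0 //.
    by rewrite mulrAC ltr_pdivrMr // ltr_pM2l.
  rewrite -/x -[X in enorm (_ - X)]scale1r -scalerBl enormZ -normrN opprB.
  have -> : 1 - 2 / (2 + d) = d / (2 + d) by field; rewrite gt_eqF.
  rewrite gtr0_norm ?divr_gt0 // mulrAC ler_pdivrMr //.
  apply: ler_pM => //; [exact: ltW|exact: enorm_ge0|exact: ltW].
- move=> y; rewrite /eball /= subr0 => yn.
  have s0 : 0 < 1 - d / 2 by lra.
  exists ((1 - d / 2) *: y).
    exists (t *: ((1 - d / 2) *: y)); last by rewrite scalerA mulVf ?scale1r // gt_eqF.
    apply: H1; first lra.
    rewrite !enormZ !gtr0_norm // mulrC ler_pM2r //.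
    have : (1 - d / 2) * enorm y <= (1 - d / 2) * 2 by rewrite ler_pM2l // ltW.
    lra.
  rewrite -[X in enorm (_ - X)]scale1r -scalerBl enormZ addrAC subrr add0r normrN gtr0_norm ?divr_gt0 //.
  have : d / 2 * enorm y <= d / 2 * 2 by rewrite ler_pM2l ?divr_gt0 // ltW.
  lra.
Qed.

Lemma slab_sum_limit :
  hausdorff (minkowski_sum (scale_set t^-1 U) (eball 0 cstar)) [set x : E | `|vert x| < 2]
    @[t --> +oo%R] --> 0%E.
Proof.
apply: cvge0_near_le => e e0; apply: (@near_pinfty_ge _ (e^-1)) => t te.
have ei : 0 < e^-1 by rewrite invr_gt0.
have t0 : 0 < t by lra.
have ti : 0 < t^-1 by rewrite invr_gt0.
have tie : t^-1 <= e by rewrite -[e]invrK lef_pV2.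
rewrite hausdorff_ge0 /=; apply: hausdorff_le; first exact: ltW.
- move=> _ [_ [z /gaussian_slabE Uz <-] [y yb <-]].
  pose x := t^-1 *: z + y.
  have vz : `|vert z| <= 1 by apply: le_trans Uz _; rewrite -expR0 ler_expR oppr_le0 horiz_ge0.
  have vx : `|vert x| < 2 + e.
    rewrite vertD vertZ; apply: le_lt_trans (ler_normD _ _) _.
    rewrite normrM (gtr0_norm ti).
    have := vert_le_enorm y; move: yb; rewrite /eball /= subr0 /cstar.
    have : t^-1 * `|vert z| <= t^-1 * 1 by rewrite ler_pM2l.
    lra.
  have e2 : 0 < 2 + e by lra.
  (* Only the vertical coordinate is contracted, from |x_N| < 2 + e to |x_N| < 2. Conversely the
     strip lies in the sum for each such t, via projection to the hyperplane x_N = 0. *)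
  exists (x - (e / (2 + e) * vert x) *: eN).
    rewrite /= vertD -scaleNr vertZ vert_eN mulr1.
    have -> : vert x - e / (2 + e) * vert x = 2 / (2 + e) * vert x by field; rewrite gt_eqF.
    rewrite normrM gtr0_norm ?divr_gt0 // mulrAC ltr_pdivrMr //.
    by rewrite ltr_pM2l.
  rewrite -/x addrAC subrr add0r enormN enormZ enorm_eN mulr1 normrM gtr0_norm ?divr_gt0 //.
  rewrite mulrAC ler_pdivrMr //.
  apply: ler_pM => //; exact: ltW.
- move=> y /= vy; exists y; last by rewrite subrr enorm0 ltW.
  exists (y - vert y *: eN).
    exists (t *: (y - vert y *: eN)); last by rewrite scalerA mulVf ?scale1r // gt_eqF.
    by apply: vert0_slab; rewrite vertZ vertD -scaleNr vertZ vert_eN mulr1 subrr mulr0.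
  exists (vert y *: eN); last by rewrite subrK.
  by rewrite /eball /= subr0 enormZ enorm_eN mulr1.
Qed.

Lemma slab_limits_differ : hausdorff (eball (0 : E) 2) [set x : E | `|vert x| < 2] <> 0%E.
Proof.
have [e e1 e0] := horizontal_unit (R := R) hm => H.
have : (1%:E <= hausdorff (eball (0 : E) 2) [set x : E | (`|vert x| < 2)%R])%E.
  apply: (@hausdorff_ger _ _ _ _ (5 *: e)).
    by rewrite /= vertZ e0 mulr0 normr0.
  move=> x; rewrite /eball /= subr0 => xn.
  have := enormB_ge (5 *: e) x; rewrite enorm_subC enormZ e1 mulr1 gtr0_norm; lra.
by rewrite H lee_fin ler10.
Qed.

End slab_asymptotics.

Theorem proposition6p3 (R : realType) (m : nat) (hm : (2 <= m + 1)%N)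
    (u : R -> 'rV[R]_(m + 1) -> R)
    (hu : bounded_classical_solution logistic \1_(gaussian_slab R m) u) :
  let U := gaussian_slab R m in
  [/\ interior U !=set0,
      forall rho : R, 0 < rho -> ~ condition_G U rho /\ ~ condition_D U rho,
      [/\ ~ property_i U u, ~ property_ii U u, ~ property_iii U u,
          ~ property_iv U u & ~ property_v U u]
    & forall lambda : R, 0 < lambda < 1 ->
        exists W1 W2 : set 'rV[R]_(m + 1),
          [/\ hausdorff (scale_set t^-1 (superlevel u lambda t)) W1
                @[t --> +oo%R] --> 0%E,
              hausdorff (minkowski_sum (scale_set t^-1 U) (eball 0 cstar)) W2
                @[t --> +oo%R] --> 0%E
            & hausdorff W1 W2 <> 0%E]].
Proof.
move=> U; split.
- by exists 0; exact: interior_slab0.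
- by move=> rho rho0; split; [exact: slab_not_G|exact: slab_not_D].
- split.
  + exact: slab_not_i.
  + exact: slab_not_ii.
  + exact: slab_not_iii.
  + exact: slab_not_iv.
  + exact: slab_not_v.
- move=> la la01; exists (eball 0 2), [set x | `|vert x| < 2]; split.
  + exact: superlevel_limit.
  + exact: slab_sum_limit.
  + exact: slab_limits_differ.
Qed.
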